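(* Let $B\in\mathcal{L}(\mathcal{K},\mathcal{H})$ with $\rho(A_B)\neq\emptyset$, and let $\mu\in\mathbb{C}$ be an isolated eigenvalue of finite algebraic multiplicity of the operator $A_B$. Assume the unique continuation hypothesis holds for $\widetilde{A}^*-\mu$ and for $A^*-\overline{\mu}$, i.e. $\ker(\widetilde{A}^*-\mu)\cap\ker\Gamma_1\cap\ker\Gamma_2=\{0\}$ and $\ker(A^*-\overline{\mu})\cap\ker\widetilde{\Gamma}_1\cap\ker\widetilde{\Gamma}_2=\{0\}$. Then $\mu$ is a pole of finite multiplicity of $M_B(\cdot)$, and the order of the pole of the resolvent $R(\cdot,A_B)$ at $\mu$ is the same as the order of the pole of $M_B(\cdot)$ at $\mu$.
   Context: Setting: $H$ is a complex Hilbert space; $A$ and $\widetilde{A}$ are closed densely defined operators on $H$ forming an adjoint pair, i.e. $A^*\supseteq\widetilde{A}$ and $\widetilde{A}^*\supseteq A$. $D(\widetilde{A}^* )$ and $D(A^* )$ carry their graph norms. A boundary triplet for the pair is fixed: Hilbert spaces $\mathcal{H},\mathcal{K}$ and linear operators $\Gamma_1:D(\widetilde{A}^* )\to\mathcal{H}$, $\Gamma_2:D(\widetilde{A}^* )\to\mathcal{K}$, $\widetilde{\Gamma}_1:D(A^* )\to\mathcal{K}$, $\widetilde{\Gamma}_2:D(A^* )\to\mathcal{H}$, bounded with respect to the graph norms and surjective, such that for $u\in D(\widetilde{A}^* )$, $v\in D(A^* )$ $$(\widetilde{A}^*u,v)_H-(u,A^*v)_H=(\Gamma_1u,\widetilde{\Gamma}_2v)_{\mathcal{H}}-(\Gamma_2u,\widetilde{\Gamma}_1v)_{\mathcal{K}},$$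 and $D(A)=D(\widetilde{A}^* )\cap\ker\Gamma_1\cap\ker\Gamma_2$, $D(\widetilde{A})=D(A^* )\cap\ker\widetilde{\Gamma}_1\cap\ker\widetilde{\Gamma}_2$. For $B\in\mathcal{L}(\mathcal{K},\mathcal{H})$ (bounded operators), $A_B:=\widetilde{A}^*|_{\ker(\Gamma_1-B\Gamma_2)}$. For $\lambda\in\rho(A_B)$ the $M$-function $M_B(\lambda):\mathrm{Ran}(\Gamma_1-B\Gamma_2)\to\mathcal{K}$ is the (well-defined) linear operator with $M_B(\lambda)(\Gamma_1-B\Gamma_2)u=\Gamma_2u$ for all $u\in\ker(\widetilde{A}^*-\lambda)$. $R(\lambda,A_B)$ denotes the resolvent of $A_B$. Poles: $M_B(\cdot)$ has a pole of order $p\ge1$ at $\mu$ if a punctured neighbourhood of $\mu$ lies in $\rho(A_B)$ and on it $M_B(\lambda)f=\sum_{n\ge-p}(\lambda-\mu)^nM_nf$ for all $f\in\mathrm{Ran}(\Gamma_1-B\Gamma_2)$, with linear operators $M_n:\mathrm{Ran}(\Gamma_1-B\Gamma_2)\to\mathcal{K}$ and $M_{-p}\neq0$; the pole has finite multiplicity if $M_n$ has finite rank for all $n<0$. An isolated point of the spectrum has finite algebraic multiplicity if the associated Riesz spectral projection has finite rank. *)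

(* Defs.v *)
From Stdlib Require Import Reals ZArith Lra.
From Coquelicot Require Import Coquelicot.

(** The inner product is linear in the first argument. *)
Record HilbertSpace := {
  hcarrier :> CompleteNormedModule C_AbsRing;
  inner : hcarrier -> hcarrier -> C;
  inner_plus_l : forall x y z : hcarrier,
    inner (plus x y) z = Cplus (inner x z) (inner y z);
  inner_scal_l : forall (a : C) (x y : hcarrier),
    inner (scal a x) y = Cmult a (inner x y);
  inner_conj : forall x y : hcarrier, inner x y = Cconj (inner y x);
  inner_norm : forall x : hcarrier, inner x x = RtoC (norm x ^ 2)
}.

Arguments inner {h} _ _.

(** Restriction of scalars from [C] to [R]: Coquelicot's [RInt] integrates
    functions [R -> V] with [V] a complete normed module over [R]. *)

Lemma real_scal_assoc (V : CompleteNormedModule C_AbsRing) (x y : R) (u : V) :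
  scal (RtoC x) (scal (RtoC y) u) = scal (RtoC (x * y)) u.
Proof. rewrite scal_assoc, RtoC_mult; reflexivity. Qed.

Lemma real_scal_distr_r (V : CompleteNormedModule C_AbsRing) (x y : R) (u : V) :
  scal (RtoC (x + y)) u = plus (scal (RtoC x) u) (scal (RtoC y) u).
Proof. rewrite RtoC_plus; exact (scal_distr_r (RtoC x) (RtoC y) u). Qed.

Definition real_ModuleSpace_mixin (V : CompleteNormedModule C_AbsRing) :=
  ModuleSpace.Mixin R_Ring V (fun (x : R) (u : V) => scal (RtoC x) u)
    (real_scal_assoc V) (fun u : V => scal_one u)
    (fun (x : R) (u v : V) => scal_distr_l (RtoC x) u v) (real_scal_distr_r V).

Definition real_ModuleSpace (V : CompleteNormedModule C_AbsRing) :
  ModuleSpace R_Ring :=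
  ModuleSpace.Pack R_Ring V
    (ModuleSpace.Class R_Ring V (AbelianGroup.class V)
       (real_ModuleSpace_mixin V)) V.

Definition real_NormedModuleAux (V : CompleteNormedModule C_AbsRing) :
  NormedModuleAux R_AbsRing :=
  NormedModuleAux.Pack R_AbsRing V
    (NormedModuleAux.Class R_AbsRing V
       (ModuleSpace.class R_Ring (real_ModuleSpace V))
       (UniformSpace.class V)) V.

Lemma real_norm_scal (V : CompleteNormedModule C_AbsRing) (x : R) (u : V) :
  norm (scal (RtoC x) u) <= Rabs x * norm u.
Proof. rewrite <- Cmod_R; exact (norm_scal (RtoC x) u). Qed.

Definition real_NormedModule_mixin (V : CompleteNormedModule C_AbsRing) :=
  NormedModule.Mixin R_AbsRing (real_NormedModuleAux V)
    (@norm C_AbsRing V) (@norm_factor C_AbsRing V)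
    (@norm_triangle C_AbsRing V) (real_norm_scal V)
    (@norm_compat1 C_AbsRing V) (@norm_compat2 C_AbsRing V)
    (@norm_eq_zero C_AbsRing V).

Definition real_NormedModule_class (V : CompleteNormedModule C_AbsRing) :=
  NormedModule.Class R_AbsRing V
    (NormedModuleAux.class R_AbsRing (real_NormedModuleAux V))
    (real_NormedModule_mixin V).

Definition restrict_scalars (V : CompleteNormedModule C_AbsRing) :
  CompleteNormedModule R_AbsRing :=
  CompleteNormedModule.Pack R_AbsRing V
    (CompleteNormedModule.Class R_AbsRing V (real_NormedModule_class V)
       (CompleteNormedModule.mixin C_AbsRing V
          (CompleteNormedModule.class C_AbsRing V))) V.

Definition is_subspace {X : HilbertSpace} (D : X -> Prop) : Prop :=
  D zero /\
  (forall x y : X, D x -> D y -> D (plus x y)) /\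
  (forall (a : C) (x : X), D x -> D (scal a x)).

Definition linear_on {X Y : HilbertSpace} (D : X -> Prop) (f : X -> Y) : Prop :=
  is_subspace D /\
  (forall x y : X, D x -> D y -> f (plus x y) = plus (f x) (f y)) /\
  (forall (a : C) (x : X), D x -> f (scal a x) = scal a (f x)).

Definition finite_rank {X Y : HilbertSpace} (D : X -> Prop) (f : X -> Y) : Prop :=
  exists (n : nat) (e : nat -> Y), forall x : X, D x ->
    exists c : nat -> C, f x = sum_n (fun i => scal (c i) (e i)) n.

(** An operator in [X] is a total function together with its domain; its values
    outside the domain are irrelevant. *)
Record operator (X : HilbertSpace) := mk_operator {
  dom : X -> Prop;
  app :> X -> X
}.

Arguments mk_operator {X} _ _.
Arguments dom {X} _ _.
Arguments app {X} _ _.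

Definition linear_op {X : HilbertSpace} (T : operator X) : Prop :=
  linear_on (dom T) T.

Definition densely_defined {X : HilbertSpace} (T : operator X) : Prop :=
  forall (x : X) (eps : R), 0 < eps ->
    exists u : X, dom T u /\ norm (minus u x) < eps.

Definition closed_op {X : HilbertSpace} (T : operator X) : Prop :=
  closed (fun p : X * X => dom T (fst p) /\ snd p = T (fst p)).

Definition extends {X : HilbertSpace} (S T : operator X) : Prop :=
  forall u : X, dom T u -> dom S u /\ S u = T u.

Definition restrict {X : HilbertSpace} (T : operator X) (P : X -> Prop) :
  operator X :=
  mk_operator (fun u => dom T u /\ P u) T.

(** [iota] picks the unique vector with the given property; here uniqueness
    holds when [T] is densely defined. *)
Definition adjoint {X : HilbertSpace} (T : operator X) : operator X :=
  mk_operator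
    (fun v => exists w : X, forall u, dom T u -> inner (T u) v = inner u w)
    (fun v => iota (fun w : X =>
       forall u, dom T u -> inner (T u) v = inner u w)).

Definition in_ker_shift {X : HilbertSpace} (T : operator X) (l : C) (u : X) : Prop :=
  dom T u /\ T u = scal l u.

Definition eigenvalue {X : HilbertSpace} (T : operator X) (l : C) : Prop :=
  exists u : X, u <> zero /\ in_ker_shift T l u.

Definition resolvent_set {X : HilbertSpace} (T : operator X) (l : C) : Prop :=
  exists S : X -> X, is_linear S /\
    (forall f : X, dom T (S f) /\ minus (T (S f)) (scal l (S f)) = f) /\
    (forall u : X, dom T u -> S (minus (T u) (scal l u)) = u).

Definition resolvent {X : HilbertSpace} (T : operator X) (l : C) (f : X) : X :=
  iota (fun u : X => dom T u /\ minus (T u) (scal l u) = f).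

Definition isolated_spectral_point {X : HilbertSpace} (T : operator X) (mu : C) : Prop :=
  ~ resolvent_set T mu /\
  exists r : R, 0 < r /\
    forall l : C, 0 < Cmod (l - mu) < r -> resolvent_set T l.

Definition cis (t : R) : C := (cos t, sin t).

(** [(1 / 2 pi i)] times the integral of [(l - T)^{-1} f = - resolvent T l f]
    over the positively oriented circle [l = mu + r e^{it}]. *)
Definition riesz_projection {X : HilbertSpace} (T : operator X) (mu : C) (r : R)
  (f : X) : X :=
  scal (- / (2 * PI * Ci))%C
    (RInt (V := restrict_scalars X)
       (fun t : R => scal (Ci * r * cis t)%C (resolvent T (mu + r * cis t)%C f))
       0 (2 * PI)).

(** The projection does not depend on [r] as long as the closed disc of radius
    [r] meets the spectrum at most in [mu]. *)
Definition finite_algebraic_multiplicity {X : HilbertSpace} (T : operator X)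
  (mu : C) : Prop :=
  exists r : R, 0 < r /\
    (forall l : C, 0 < Cmod (l - mu) <= r -> resolvent_set T l) /\
    finite_rank (fun _ => True) (riesz_projection T mu r).

Definition adjoint_pair {X : HilbertSpace} (A At : operator X) : Prop :=
  extends (adjoint A) At /\ extends (adjoint At) A.

Definition graph_norm {X : HilbertSpace} (T : operator X) (u : X) : R :=
  sqrt (norm u ^ 2 + norm (T u) ^ 2).

Definition graph_bounded {X Y : HilbertSpace} (T : operator X) (G : X -> Y) : Prop :=
  exists M : R, forall u : X, dom T u -> norm (G u) <= M * graph_norm T u.

Definition surjective_on {X Y : HilbertSpace} (D : X -> Prop) (G : X -> Y) : Prop :=
  forall y : Y, exists u : X, D u /\ G u = y.

Definition boundary_operator {X Y : HilbertSpace} (T : operator X) (G : X -> Y) : Prop :=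
  linear_on (dom T) G /\ graph_bounded T G /\ surjective_on (dom T) G.

Record boundary_triplet {X HH KK : HilbertSpace} (A At : operator X)
  (G1 : X -> HH) (G2 : X -> KK) (Gt1 : X -> KK) (Gt2 : X -> HH) : Prop := {
  bt_G1 : boundary_operator (adjoint At) G1;
  bt_G2 : boundary_operator (adjoint At) G2;
  bt_Gt1 : boundary_operator (adjoint A) Gt1;
  bt_Gt2 : boundary_operator (adjoint A) Gt2;
  bt_green : forall u v : X, dom (adjoint At) u -> dom (adjoint A) v ->
    (inner (adjoint At u) v - inner u (adjoint A v))%C =
    (inner (G1 u) (Gt2 v) - inner (G2 u) (Gt1 v))%C;
  bt_dom_A : forall u : X,
    dom A u <-> dom (adjoint At) u /\ G1 u = zero /\ G2 u = zero;
  bt_dom_At : forall v : X,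
    dom At v <-> dom (adjoint A) v /\ Gt1 v = zero /\ Gt2 v = zero
}.

Definition unique_continuation {X Y Z : HilbertSpace} (T : operator X) (l : C)
  (G1 : X -> Y) (G2 : X -> Z) : Prop :=
  forall u : X, in_ker_shift T l u -> G1 u = zero -> G2 u = zero -> u = zero.

Definition bdry_map {X HH KK : HilbertSpace} (G1 : X -> HH) (G2 : X -> KK)
  (B : KK -> HH) (u : X) : HH :=
  minus (G1 u) (B (G2 u)).

Definition bdry_range {X HH KK : HilbertSpace} (At : operator X)
  (G1 : X -> HH) (G2 : X -> KK) (B : KK -> HH) (f : HH) : Prop :=
  exists u : X, dom (adjoint At) u /\ bdry_map G1 G2 B u = f.

Definition A_B {X HH KK : HilbertSpace} (At : operator X)
  (G1 : X -> HH) (G2 : X -> KK) (B : KK -> HH) : operator X :=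
  restrict (adjoint At) (fun u => bdry_map G1 G2 B u = zero).

(** The value at [f] is [G2 u] for any [u] in [ker (At^* - l)] with
    [(G1 - B G2) u = f]; it is meaningful for [l] in the resolvent set of [A_B]
    and [f] in the range of [G1 - B G2]. *)
Definition M_function {X HH KK : HilbertSpace} (At : operator X)
  (G1 : X -> HH) (G2 : X -> KK) (B : KK -> HH) (l : C) (f : HH) : KK :=
  iota (fun g : KK => exists u : X,
    in_ker_shift (adjoint At) l u /\ bdry_map G1 G2 B u = f /\ G2 u = g).

Definition Cpow_Z (z : C) (n : Z) : C :=
  match n with
  | Z0 => RtoC 1
  | Zpos p => Cpow z (Pos.to_nat p)
  | Zneg p => Cinv (Cpow z (Pos.to_nat p))
  end.

(** The [k]-th term, that of index [n = k - p], of the Laurent series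
    [sum_{n >= -p} z^n c_n f]. *)
Definition laurent_term {X Y : HilbertSpace} (c : Z -> X -> Y) (p : nat) (z : C)
  (f : X) (k : nat) : Y :=
  let n := (Z.of_nat k - Z.of_nat p)%Z in scal (Cpow_Z z n) (c n f).

(** [c] is the family of Laurent coefficients, from index [- p] on, of a pole of
    order [p] of the M-function at [mu]; convergence is pointwise. *)
Definition M_pole_coeffs {X HH KK : HilbertSpace} (At : operator X)
  (G1 : X -> HH) (G2 : X -> KK) (B : KK -> HH) (mu : C) (p : nat)
  (c : Z -> HH -> KK) : Prop :=
  let Ran := bdry_range At G1 G2 B in
  (1 <= p)%nat /\
  (forall n : Z, (- Z.of_nat p <= n)%Z -> linear_on Ran (c n)) /\
  (exists f, Ran f /\ c (- Z.of_nat p)%Z f <> zero) /\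
  exists r : R, 0 < r /\ forall l : C, 0 < Cmod (l - mu) < r ->
    resolvent_set (A_B At G1 G2 B) l /\
    forall f, Ran f ->
      is_series (laurent_term c p (l - mu)%C f) (M_function At G1 G2 B l f).

Definition M_pole_finite_multiplicity {X HH KK : HilbertSpace} (At : operator X)
  (G1 : X -> HH) (G2 : X -> KK) (B : KK -> HH) (mu : C) (p : nat) : Prop :=
  exists c : Z -> HH -> KK,
    M_pole_coeffs At G1 G2 B mu p c /\
    forall n : Z, (- Z.of_nat p <= n < 0)%Z ->
      finite_rank (bdry_range At G1 G2 B) (c n).

(** Pole of order [p] of [l => (T - l)^{-1}] at [mu]: the coefficients are bounded
    operators and the Laurent series converges in operator norm. *)
Definition resolvent_pole {X : HilbertSpace} (T : operator X) (mu : C) (p : nat) : Prop :=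
  exists c : Z -> X -> X,
  (1 <= p)%nat /\
  (forall n : Z, (- Z.of_nat p <= n)%Z -> is_linear (c n)) /\
  (exists f : X, c (- Z.of_nat p)%Z f <> zero) /\
  exists r : R, 0 < r /\ forall l : C, 0 < Cmod (l - mu) < r ->
    resolvent_set T l /\
    forall eps : R, 0 < eps ->
      exists N : nat, forall m : nat, (N <= m)%nat -> forall f : X,
        norm (minus (sum_n (laurent_term c p (l - mu)%C f) m) (resolvent T l f))
        <= eps * norm f.

(* Main.v *)
Require Import Defs.
From Stdlib Require Import Reals ZArith Lra Lia Classical List.
From Stdlib Require Import FunctionalExtensionality ProofIrrelevance ClassicalEpsilon.
From Coquelicot Require Import Coquelicot.
From Stdlib Require Import ssreflect.

(** The idea: near [mu] both the resolvent of [T = A_B] and the M-function are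
    governed by one and the same family of Laurent coefficients, and the
    leading one cannot be lost on the way to the boundary.

    Fix a point [mu + w] of the resolvent set, write [R0] for the resolvent
    there and [K = 1 + w R0], which is [(T - mu) R0]. Integrating the resolvent
    over a circle around [mu] against [dl / (l - mu)] gives a bounded operator
    commuting with [R0] that inverts [T - mu] up to the Riesz projection [P];
    multiplied by [T - (mu + w)] it becomes a bounded [St] with
    [K St = 1 - P] ([riesz_complement]). From here on everything happens in the
    commutative algebra generated by [R0] and [St]. Since [P] has finite rank,
    [P] is annihilated by some [K^k (1 - K G)] ([annihilator]), so a Fitting
    argument replaces [P] by a projection of finite rank on which [K] is
    nilpotent while [K] is invertible on the complement
    ([fitting_projection]). This produces operators [c_0, c_1, ...] such that
    [(K - (l - mu) R0) sum_k (l - mu)^(k - p) c_k] telescopes to the identity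
    ([laurent_coefficients]): [R0 c_k] are the Laurent coefficients of the
    resolvent, the error after finitely many terms being an explicit geometric
    term ([laurent_sum_resolvent]).

    For the M-function, let [U f] be the element of [ker (At^* - (mu + w))] with
    boundary value [f]. Then
    [M(l) f = G2 (U f) + (l - (mu + w)) G2 (R(l) (U f))]
    ([M_function_transport]), and [G2 R(l)] is bounded, so the expansion of the
    resolvent yields one of [M] with a pole of order at most [p] and
    finite-rank principal part ([M_series], [M_coefficient_finite_rank]). Its
    coefficient of index [- p] is [- w G2 R0 c_0 U], and it remains to see that
    it is not zero ([leading_coefficient_visible]). The operator [Z = R0 c_0]
    maps into [ker (T - mu)]. If [G2 Z] vanished on [ker (At^* - (mu + w))],
    unique continuation for [At^* - mu] would make [Z] vanish there, and then
    [Z] would annihilate the range of [At^* - mu]. A non-zero vector [v]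
    orthogonal to [ker Z] would satisfy [At v = conj mu v] because
    [At^** = At], contradicting unique continuation for [A^* - conj mu]. *)

(** * Vector identities by ring normalisation *)

Section SquareZero.
Context (V : HilbertSpace).

(** The square-zero extension of [C] by [V]: pairs with
    [(a, x) (b, y) = (a b, a y + b x)]. Vectors and scalars both embed in this
    commutative ring, and the scalar action becomes multiplication, so that
    identities between vectors are identities of ring elements. *)
Definition sz : Type := (C * V)%type.

Definition sz_add (p q : sz) : sz := (fst p + fst q, plus (snd p) (snd q))%C.
Definition sz_mul (p q : sz) : sz :=
  (fst p * fst q, plus (scal (fst p) (snd q)) (scal (fst q) (snd p)))%C.
Definition sz_opp (p : sz) : sz := (- fst p, opp (snd p))%C.
Definition sz_zero : sz := (RtoC 0, zero).
Definition sz_one : sz := (RtoC 1, zero).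
Definition sz_scalar (a : C) : sz := (a, zero).
Definition sz_vector (x : V) : sz := (RtoC 0, x).

Lemma scal_C0 (x : V) : scal (RtoC 0) x = zero.
Proof. exact (scal_zero_l x). Qed.
Lemma scal_C1 (x : V) : scal (RtoC 1) x = x.
Proof. exact (scal_one x). Qed.

Lemma sz_ring : ring_theory sz_zero sz_one sz_add sz_mul
  (fun p q => sz_add p (sz_opp q)) sz_opp (@eq sz).
Proof.
split; rewrite /sz_add /sz_mul /sz_zero /sz_one /sz_opp.
- case=> a x /=. by rewrite Cplus_0_l plus_zero_l.
- case=> a x [b y] /=. by rewrite Cplus_comm plus_comm.
- case=> a x [b y] [c z] /=. by rewrite Cplus_assoc plus_assoc.
- case=> a x /=. by rewrite Cmult_1_l scal_C1 scal_zero_r plus_zero_r.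
- case=> a x [b y] /=. by rewrite Cmult_comm plus_comm.
- case=> a x [b y] [c z] /=. rewrite !scal_distr_l !scal_assoc Cmult_assoc -plus_assoc.
  congr pair. congr plus. congr plus; congr scal; apply: Cmult_comm.
- case=> a x [b y] [c z] /=. rewrite Cmult_plus_distr_r scal_distr_l.
  rewrite (scal_distr_r a b z). congr pair.
  rewrite -!plus_assoc. congr plus. rewrite !plus_assoc. congr plus. exact: plus_comm.
- by [].
- case=> a x /=. by rewrite Cplus_opp_r plus_opp_r.
Qed.

Lemma sz_vector_inj x y : sz_vector x = sz_vector y -> x = y.
Proof. by case. Qed.
Lemma sz_vector_plus x y : sz_vector (plus x y) = sz_add (sz_vector x) (sz_vector y).
Proof. by rewrite /sz_add /= Cplus_0_l. Qed.
Lemma sz_vector_opp x : sz_vector (opp x) = sz_opp (sz_vector x).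
Proof. by rewrite /sz_opp /= Copp_0. Qed.
Lemma sz_vector_scal a x : sz_vector (scal a x) = sz_mul (sz_scalar a) (sz_vector x).
Proof. by rewrite /sz_mul /= Cmult_0_r scal_zero_r plus_zero_r. Qed.
Lemma sz_scalar_plus a b : sz_scalar (a + b)%C = sz_add (sz_scalar a) (sz_scalar b).
Proof. by rewrite /sz_add /= plus_zero_l. Qed.
Lemma sz_scalar_mult a b : sz_scalar (a * b)%C = sz_mul (sz_scalar a) (sz_scalar b).
Proof. by rewrite /sz_mul /= !scal_zero_r plus_zero_l. Qed.
Lemma sz_scalar_opp a : sz_scalar (- a)%C = sz_opp (sz_scalar a).
Proof. by rewrite /sz_opp /= opp_zero. Qed.
Lemma sz_zeroE : sz_vector zero = sz_zero. Proof. by []. Qed.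
Lemma sz_scalar0 : sz_scalar (RtoC 0) = sz_zero. Proof. by []. Qed.
Lemma sz_scalar1 : sz_scalar (RtoC 1) = sz_one. Proof. by []. Qed.

End SquareZero.

Ltac vec := rewrite /minus ?/Cminus ?/Cdiv; apply: sz_vector_inj;
  rewrite ?(sz_vector_plus,sz_vector_opp,sz_vector_scal,sz_zeroE,sz_scalar_plus,
    sz_scalar_mult,sz_scalar_opp,sz_scalar0,sz_scalar1); ring.

(** * Finitely generated subspaces *)

Section Span.
Context (X : HilbertSpace).
Add Ring sz_ring_span : (sz_ring X).

Fixpoint span (l : list X) (v : X) : Prop :=
  match l with
  | nil => v = zero
  | e :: l' => exists c : C, span l' (minus v (scal c e))
  end.

Lemma subspace_opp (D : X -> Prop) : is_subspace D -> forall x, D x -> D (opp x).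
Proof.
move=> [_ [_ hs]] x hx.
have -> : opp x = scal (- (1))%C x by vec.
exact: hs.
Qed.

Lemma subspace_minus (D : X -> Prop) :
  is_subspace D -> forall x y, D x -> D y -> D (minus x y).
Proof.
move=> hD x y hx hy. apply: (proj1 (proj2 hD)) => //. exact: subspace_opp.
Qed.

Lemma span_subspace l : is_subspace (span l).
Proof.
elim: l => [|e l [h0 [hp hs]]] /=.
- split; [by []|split].
  + move=> x y -> ->. exact: plus_zero_l.
  + move=> a x ->. exact: scal_zero_r.
- split; [|split].
  + exists (RtoC 0). have -> : minus zero (scal (RtoC 0) e) = zero by vec. exact: h0.
  + move=> x y [a ha] [b hb]. exists (a + b)%C.
    have -> : minus (plus x y) (scal (a + b)%C e) =
      plus (minus x (scal a e)) (minus y (scal b e)) by vec.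
    exact: hp.
  + move=> a x [b hb]. exists (a * b)%C.
    have -> : minus (scal a x) (scal (a * b)%C e) = scal a (minus x (scal b e)) by vec.
    exact: hs.
Qed.

Lemma span_mem l x : In x l -> span l x.
Proof.
elim: l => [//|e l IH] /= [->|hx].
- exists (RtoC 1). have -> : minus x (scal (RtoC 1) x) = zero by vec.
  exact: (proj1 (span_subspace l)).
- exists (RtoC 0). have -> : minus x (scal (RtoC 0) e) = x by vec. exact: IH.
Qed.

Lemma subspace_sum_n (D : X -> Prop) (u : nat -> X) n :
  is_subspace D -> (forall i, (i <= n)%nat -> D (u i)) -> D (sum_n u n).
Proof.
move=> hD. elim: n => [|n IH] hu.
- rewrite sum_O. exact: hu.
- rewrite sum_Sn. apply: (proj1 (proj2 hD)); [apply: IH => i hi|]; apply: hu; lia.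
Qed.

Lemma span_of_sum_n (c : nat -> C) (e : nat -> X) n :
  span (map e (seq 0 (S n))) (sum_n (fun i => scal (c i) (e i)) n).
Proof.
apply: subspace_sum_n; first exact: span_subspace.
move=> i hi. apply: (proj2 (proj2 (span_subspace _))). apply: span_mem.
apply: in_map. apply/in_seq. lia.
Qed.

Lemma sum_n_of_span l v : span l v ->
  exists c : nat -> C, v = sum_n (fun i => scal (c i) (nth i l zero)) (length l).
Proof.
elim: l v => [|e l IH] v /=.
- move=> ->. exists (fun _ => RtoC 0). rewrite sum_O /=. by rewrite scal_zero_r.
- move=> [a /IH [c hc]].
  exists (fun i => match i with O => a | S j => c j end).
  rewrite /sum_n sum_Sn_m; last lia. rewrite -sum_n_m_S.
  rewrite -/(sum_n _ _) -hc. vec.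
Qed.

(** Generators can be found inside the subspace itself: peel off the basis
    vectors one by one, using an element with a non-zero coordinate along the
    current one, if there is any, to eliminate that coordinate. *)
Lemma subspace_generators (l : list X) (D : X -> Prop) :
  is_subspace D -> (forall v, D v -> span l v) ->
  exists g, List.Forall D g /\ (forall v, D v -> span g v).
Proof.
elim: l D => [|e l IH] D hD hl.
  by exists nil.
case: (classic (exists v0 c, D v0 /\ span l (minus v0 (scal c e)) /\ c <> RtoC 0)).
- move=> [v0 [c [hv0 [hc c0]]]].
  have hsl := span_subspace l.
  case: (IH (fun v => D v /\ span l v)).
  + split; [|split].
    * split; [exact: (proj1 hD)|exact: (proj1 hsl)].
    * move=> x y [dx sx] [dy sy].
      split; [exact: (proj1 (proj2 hD))|exact: (proj1 (proj2 hsl))].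
    * move=> a x [dx sx].
      split; [exact: (proj2 (proj2 hD))|exact: (proj2 (proj2 hsl))].
  + by move=> v [].
  + move=> g [hg hgs]. exists (v0 :: g). split.
      constructor => //. apply: Forall_impl hg. by move=> ? [].
    move=> v hv /=. case: (hl v hv) => d hd. exists (d * / c)%C.
    apply: hgs. split.
      apply: subspace_minus => //. exact: (proj2 (proj2 hD)).
    have -> : minus v (scal (d * / c)%C v0) =
      minus (minus v (scal d e)) (scal (d * / c)%C (minus v0 (scal c e))).
      have hd' : d = (d * / c * c)%C by field.
      rewrite {2}hd'. vec.
    apply: subspace_minus => //. exact: (proj2 (proj2 hsl)).
- move=> hn. apply: IH => // v hv. case: (hl v hv) => c hc.
  case: (classic (c = RtoC 0)) => c0.
  + move: hc. rewrite c0. have -> : minus v (scal (RtoC 0) e) = v by vec. by [].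
  + case: hn. by exists v, c.
Qed.

(** In a finite-dimensional space some term of any sequence is a combination of
    later terms. Saying it through all subspaces that contain the later terms
    spares any bookkeeping of coefficients. The induction is on the number of
    spanning vectors: either the first coordinate is eventually zero, or each
    term can be reduced by a later one whose first coordinate is not zero. *)
Lemma sequence_dependence (l : list X) (u : nat -> X) :
  (forall j, span l (u j)) ->
  exists k, forall D : X -> Prop, is_subspace D ->
    (forall j, (k < j)%nat -> D (u j)) -> D (u k).
Proof.
elim: l u => [|e l IH] u /= hu.
  exists O => D hD _. rewrite hu. exact: (proj1 hD).
case: (choice _ hu) => c hc.
case: (classic (exists J, forall j, (J <= j)%nat -> c j = RtoC 0)).
- move=> [J hJ]. case: (IH (fun j => u (J + j)%nat)).
    move=> j. move: (hc (J + j)%nat). rewrite hJ; last lia.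
    by have -> : minus (u (J + j)%nat) (scal (RtoC 0) e) = u (J + j)%nat by vec.
  move=> k hk. exists (J + k)%nat => D hD hDu. apply: hk => // j hj. apply: hDu. lia.
- move=> hn.
  have hnext : forall j, exists i, (j < i)%nat /\ c i <> RtoC 0.
    move=> j. apply: NNPP => h. apply: hn. exists (S j) => i hi.
    apply: NNPP => hci. apply: h. by exists i.
  case: (choice _ hnext) => nx hnx.
  case: (IH (fun j => minus (u j) (scal (c j * / c (nx j))%C (u (nx j))))).
    move=> j. case: (hnx j) => _ c0.
    have -> : minus (u j) (scal (c j * / c (nx j))%C (u (nx j))) =
      minus (minus (u j) (scal (c j) e))
        (scal (c j * / c (nx j))%C (minus (u (nx j)) (scal (c (nx j)) e))).
      have hd' : c j = (c j * / c (nx j) * c (nx j))%C by field.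
      rewrite {2}hd'. vec.
    have hsl := span_subspace l.
    apply: subspace_minus => //. exact: (proj2 (proj2 hsl)).
  move=> k hk. exists k => D hD hDu.
  have -> : u k = plus (minus (u k) (scal (c k * / c (nx k))%C (u (nx k))))
    (scal (c k * / c (nx k))%C (u (nx k))) by vec.
  have hs : forall j a, (k <= j)%nat -> D (scal a (u (nx j))).
    move=> j a hj. apply: (proj2 (proj2 hD)). apply: hDu. case: (hnx j). lia.
  apply: (proj1 (proj2 hD)); last exact: hs.
  apply: hk => // j hj. apply: subspace_minus => //; first exact: hDu.
  apply: hs. lia.
Qed.
End Span.

Arguments span {X} _ _.

Lemma span_linear_image (X Y : HilbertSpace) (L : X -> Y) l v :
  is_linear L -> span l v -> span (map L l) (L v).
Proof.
move=> hL. elim: l v => [|e l IH] v /=.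
- move=> ->. exact: linear_zero.
- move=> [c /IH]. rewrite linear_minus // linear_scal // => h. by exists c.
Qed.

(** * The commutative algebra generated by two commuting operators *)

Section BicommutantRing.
Context (X : HilbertSpace) (a b : X -> X).
Add Ring sz_ring_bicommutant : (sz_ring X).

(** The bicommutant of [a] and [b]. When [a] and [b] commute it is a commutative
    ring, and it is closed under every construction needed below; hence [ring]
    decides the identities between the operators built from [a] and [b]. *)
Definition in_bicommutant (f : X -> X) : Prop :=
  is_linear f /\
  forall g : X -> X, is_linear g ->
    (forall x, g (a x) = a (g x)) -> (forall x, g (b x) = b (g x)) ->
    forall x, g (f x) = f (g x).

Definition bicommutant : Type := {f : X -> X | in_bicommutant f}.

Definition op_of (f : bicommutant) : X -> X := proj1_sig f.
Coercion op_of : bicommutant >-> Funclass.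

Lemma op_linear (f : bicommutant) : is_linear f.
Proof. exact: (proj1 (proj2_sig f)). Qed.

Lemma op_plus (f : bicommutant) x y : f (plus x y) = plus (f x) (f y).
Proof. apply: linear_plus. exact: op_linear. Qed.
Lemma op_scal (f : bicommutant) c x : f (scal c x) = scal c (f x).
Proof. apply: linear_scal. exact: op_linear. Qed.
Lemma op_zero (f : bicommutant) : f zero = zero.
Proof. apply: linear_zero. exact: op_linear. Qed.

Lemma op_commutes (f : bicommutant) (g : X -> X) : is_linear g ->
  (forall x, g (a x) = a (g x)) -> (forall x, g (b x) = b (g x)) ->
  forall x, g (f x) = f (g x).
Proof. exact: (proj2 (proj2_sig f)). Qed.

Lemma op_eq (f g : bicommutant) : (forall x, f x = g x) -> f = g.
Proof.
case: f g => [f hf] [g hg] /= h.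
have e : f = g by apply: functional_extensionality.
subst g. by rewrite (proof_irrelevance _ hf hg).
Qed.

Lemma is_linear_plus_fct (f g : X -> X) :
  is_linear f -> is_linear g -> is_linear (fun x => plus (f x) (g x)).
Proof.
move=> hf hg.
apply: (is_linear_comp (fun x => (f x, g x)) (fun t : X * X => plus (fst t) (snd t))).
- exact: is_linear_prod.
- exact: is_linear_plus.
Qed.

Lemma is_linear_scal_C (c : C) : is_linear (fun x : X => scal c x).
Proof. apply: is_linear_scal_r. exact: Cmult_comm. Qed.

Lemma add_in (f g : bicommutant) : in_bicommutant (fun x => plus (f x) (g x)).
Proof.
split; first by apply: is_linear_plus_fct; exact: op_linear.
move=> h hl ha hb x. by rewrite linear_plus // !(op_commutes _ h).
Qed.
Lemma mul_in (f g : bicommutant) : in_bicommutant (fun x => f (g x)).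
Proof.
split; first by apply: (is_linear_comp g f); exact: op_linear.
move=> h hl ha hb x. by rewrite !(op_commutes _ h).
Qed.
Lemma opp_in (f : bicommutant) : in_bicommutant (fun x => opp (f x)).
Proof.
split; first by apply: (is_linear_comp f opp); [exact: op_linear|exact: is_linear_opp].
move=> h hl ha hb x. by rewrite linear_opp // !(op_commutes _ h).
Qed.
Lemma scalar_in (c : C) : in_bicommutant (fun x => scal c x).
Proof.
split; first exact: is_linear_scal_C.
move=> h hl ha hb x. by rewrite linear_scal.
Qed.

Definition op_add f g : bicommutant := exist _ _ (add_in f g).
Definition op_mul f g : bicommutant := exist _ _ (mul_in f g).
Definition op_opp f : bicommutant := exist _ _ (opp_in f).
Definition op_scalar c : bicommutant := exist _ _ (scalar_in c).
Definition op_sub f g := op_add f (op_opp g).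

Context (ha : is_linear a) (hb : is_linear b) (hab : forall x, a (b x) = b (a x)).

Lemma op_mul_comm f g : op_mul f g = op_mul g f.
Proof.
apply: op_eq => x /=. apply: op_commutes; first exact: op_linear.
- move=> y. symmetry. exact: op_commutes.
- move=> y. symmetry. exact: op_commutes.
Qed.

Lemma bicommutant_ring : ring_theory (op_scalar (RtoC 0)) (op_scalar (RtoC 1))
  op_add op_mul op_sub op_opp (@eq bicommutant).
Proof.
split.
- move=> f. apply: op_eq => x /=. vec.
- move=> f g. apply: op_eq => x /=. vec.
- move=> f g h. apply: op_eq => x /=. vec.
- move=> f. apply: op_eq => x /=. vec.
- exact: op_mul_comm.
- by move=> f g h; apply: op_eq.
- by move=> f g h; apply: op_eq.
- by [].
- move=> f. apply: op_eq => x /=. vec.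
Qed.

Lemma left_in_bicommutant : in_bicommutant a.
Proof. by split. Qed.
Lemma right_in_bicommutant : in_bicommutant b.
Proof. by split. Qed.

Fixpoint op_pow (f : bicommutant) (n : nat) : bicommutant :=
  match n with O => op_scalar (RtoC 1) | S n => op_mul f (op_pow f n) end.

Fixpoint op_geom (f : bicommutant) (n : nat) : bicommutant :=
  match n with O => op_scalar (RtoC 0) | S n => op_add (op_geom f n) (op_pow f n) end.

End BicommutantRing.

(** * Laurent coefficients of an operator invertible up to finite rank *)

Lemma least_witness (D : nat -> Prop) n : D n ->
  exists p, D p /\ forall j, (j < p)%nat -> ~ D j.
Proof.
elim/(well_founded_ind lt_wf): n => n IH hn.
case: (classic (exists j, (j < n)%nat /\ D j)) => [[j [hj hD]]|h].
- exact: IH hj hD.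
- exists n; split=> // j hj hD. apply: h. by exists j.
Qed.

Section LaurentCoefficients.
Context (X : HilbertSpace) (R0 St : X -> X) (hR0 : is_linear R0) (hSt : is_linear St)
  (hcomm : forall x, R0 (St x) = St (R0 x)).
Context (R0_inj : forall x, R0 x = zero -> x = zero).
Context (w : C) (w_neq0 : w <> RtoC 0).
Add Ring sz_ring_laurent : (sz_ring X).

Notation alg := (bicommutant X R0 St).
Add Ring bicommutant_ring_laurent : (bicommutant_ring X R0 St hR0 hSt hcomm).

Notation "0" := (op_scalar X R0 St (RtoC 0)).
Notation "1" := (op_scalar X R0 St (RtoC 1)).
Notation "f + g" := (op_add X R0 St f g).
Notation "f * g" := (op_mul X R0 St f g).
Notation "f - g" := (op_sub X R0 St f g).
Notation "- f" := (op_opp X R0 St f).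
Notation "f ^ n" := (op_pow X R0 St f n).

Let R : alg := exist _ _ (left_in_bicommutant X R0 St hR0).
Let T : alg := exist _ _ (right_in_bicommutant X R0 St hSt).
Let W : alg := op_scalar X R0 St w.
Let W' : alg := op_scalar X R0 St (/ w)%C.
Let K : alg := 1 + W * R.
Let P : alg := 1 - K * T.

Lemma W_inv : W * W' = 1.
Proof. apply: op_eq => x /=. rewrite scal_assoc. congr scal. exact: Cinv_r. Qed.

Lemma R_of_K : R = W' * (K - 1).
Proof. transitivity (W * W' * R); [rewrite W_inv; ring|rewrite /K; ring]. Qed.

Lemma op_pow_add (f : alg) m n : f ^ (m + n) = f ^ m * f ^ n.
Proof. elim: m => [|m IH] /=; [ring|rewrite IH; ring]. Qed.

Lemma op_pow_mul (f g : alg) n : (f * g) ^ n = f ^ n * g ^ n.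
Proof. elim: n => [|n IH] /=; [ring|rewrite IH; ring]. Qed.

Lemma op_geomE (f : alg) n : (1 - f) * op_geom X R0 St f n = 1 - f ^ n.
Proof.
elim: n => [|n IH] /=; first ring.
transitivity ((1 - f) * op_geom X R0 St f n + (1 - f) * f ^ n); first ring.
rewrite IH. ring.
Qed.

Lemma R_cancel (f : alg) : R * f = 0 -> f = 0.
Proof.
move=> h. apply: op_eq => x /=. rewrite scal_C0. apply: R0_inj.
have : (R * f) x = (0 : alg) x by rewrite h.
by rewrite /= scal_C0.
Qed.

Lemma R_pow_cancel (f : alg) n : R ^ n * f = 0 -> f = 0.
Proof.
elim: n f => [|n IH] f /= h.
- rewrite -h. ring.
- apply: IH. apply: R_cancel. rewrite -h. ring.
Qed.

Context (l : list X) (P_span : forall f, span l (P f)).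

(** The vectors [K^j v] stay in the finite-dimensional range of [P], so some
    [K^k v] is a combination of later ones, that is, equal to
    [K^(k + 1) (G v)]. *)
Lemma annihilator_at (v : X) : (exists f, v = P f) ->
  exists k (G : alg), (K ^ k * (1 - K * G)) v = zero.
Proof.
move=> [f ->].
case: (sequence_dependence X l (fun j => (K ^ j) (P f))).
  move=> j.
  have -> : (K ^ j) (P f) = P ((K ^ j) f).
    change ((K ^ j * P) f = (P * K ^ j) f). congr (op_of _ _ _ _ _). ring.
  exact: P_span.
move=> k hk.
case: (hk (fun x => exists G : alg, x = (K * K ^ k * G) (P f))).
- split; [|split].
  + exists 0. have -> : K * K ^ k * 0 = 0 by ring. by rewrite /= scal_C0.
  + move=> x y [G1 ->] [G2 ->]. exists (G1 + G2).
    change ((K * K ^ k * G1 + K * K ^ k * G2) (P f) = (K * K ^ k * (G1 + G2)) (P f)).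
    congr (op_of _ _ _ _ _). ring.
  + move=> c x [G ->]. exists (op_scalar X R0 St c * G).
    change ((op_scalar X R0 St c * (K * K ^ k * G)) (P f) =
      (K * K ^ k * (op_scalar X R0 St c * G)) (P f)).
    congr (op_of _ _ _ _ _). ring.
- move=> j hj. exists (K ^ (j - S k)).
  have -> : j = (S k + (j - S k))%nat by lia.
  have -> : (S k + (j - S k) - S k)%nat = (j - S k)%nat by lia.
  by rewrite op_pow_add.
- move=> G hG. exists k, G.
  have -> : K ^ k * (1 - K * G) = K ^ k - K * K ^ k * G by ring.
  change (plus ((K ^ k) (P f)) (opp ((K * K ^ k * G) (P f))) = zero).
  rewrite hG. vec.
Qed.

(** Annihilators of two vectors multiply, because
    [(1 - K G1) (1 - K G2)] is again of the form [1 - K G]. *)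
Lemma annihilator_on (g : list X) : List.Forall (fun v => exists f, v = P f) g ->
  exists k (G : alg), forall v, span g v -> (K ^ k * (1 - K * G)) v = zero.
Proof.
elim: g => [|v g IH] hg.
- exists O, 0 => v hv. have -> : v = zero by []. exact: op_zero.
- inversion hg as [|v' g' hv hg']; subst.
  case: (annihilator_at v hv) => k1 [G1 h1].
  case: (IH hg') => k2 [G2 h2].
  exists (k1 + k2)%nat, (G1 + G2 - K * G1 * G2) => u [c hc].
  have -> : K ^ (k1 + k2) * (1 - K * (G1 + G2 - K * G1 * G2)) =
    (K ^ k1 * (1 - K * G1)) * (K ^ k2 * (1 - K * G2)) by rewrite op_pow_add; ring.
  have -> : u = plus (minus u (scal c v)) (scal c v) by vec.
  rewrite op_plus op_scal.
  have -> : ((K ^ k1 * (1 - K * G1)) * (K ^ k2 * (1 - K * G2))) v = zero.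
    have -> : (K ^ k1 * (1 - K * G1)) * (K ^ k2 * (1 - K * G2)) =
      (K ^ k2 * (1 - K * G2)) * (K ^ k1 * (1 - K * G1)) by ring.
    change ((K ^ k2 * (1 - K * G2)) ((K ^ k1 * (1 - K * G1)) v) = zero).
    rewrite h1. exact: op_zero.
  change (plus ((K ^ k1 * (1 - K * G1)) ((K ^ k2 * (1 - K * G2)) (minus u (scal c v))))
    (scal c zero) = zero).
  rewrite h2 // op_zero. vec.
Qed.

Lemma annihilator : exists k (G : alg), K ^ k * (1 - K * G) * P = 0.
Proof.
have hD : is_subspace (fun v => exists f, v = P f).
  split; [|split].
  + exists zero. by rewrite op_zero.
  + move=> x y [f ->] [g ->]. exists (plus f g). by rewrite op_plus.
  + move=> c x [f ->]. exists (scal c f). by rewrite op_scal.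
case: (subspace_generators X l _ hD); first by move=> v [f ->].
move=> g [hg hspan]. case: (annihilator_on g hg) => k [G h].
exists k, G. apply: op_eq => f.
change ((K ^ k * (1 - K * G)) (P f) = scal (RtoC 0) f).
rewrite scal_C0. apply: h. apply: hspan. by exists f.
Qed.

Context (K_ker : exists u, u <> zero /\ K u = zero).

(** With [P0 = (1 - K G) P] and [S1 = T + G P] one has [x := K S1 = 1 - P0] and
    [K^k P0 = 0], so [K^k x = K^k] and the powers of [x] stabilise from [x^k] on.
    Hence [Q = x^k] is a projection; [J = S1 Q] inverts [K] on its range, [K] is
    nilpotent on the range of [1 - Q], and [1 - Q], being a multiple of [1 - x],
    factors through [P]. *)
Lemma fitting_projection : exists k (Q J : alg),
  K * J = Q /\ Q * J = J /\ Q * Q = Q /\ K ^ k * Q = K ^ k /\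
  exists F : alg, 1 - Q = P * F.
Proof.
case: annihilator => k [G h].
pose S1 := T + G * P. pose x := K * S1.
have hx : x = 1 - (1 - K * G) * P by rewrite /x /S1 /P; ring.
have hKx : K ^ k * x = K ^ k.
  rewrite hx. transitivity (K ^ k - K ^ k * (1 - K * G) * P); first ring.
  rewrite h. ring.
have hKxj : forall j, K ^ k * x ^ j = K ^ k.
  elim=> [|j IH] /=; first ring.
  transitivity (K ^ k * x * x ^ j); first ring. by rewrite hKx.
have hxk : x * x ^ k = x ^ k.
  have -> : x ^ k = K ^ k * S1 ^ k by rewrite /x op_pow_mul.
  transitivity (K ^ k * x * S1 ^ k); first ring. by rewrite hKx.
have hxkj : forall j, x ^ j * x ^ k = x ^ k.
  elim=> [|j IH] /=; first ring.
  transitivity (x * (x ^ j * x ^ k)); first ring. by rewrite IH hxk.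
exists k, (x ^ k), (S1 * x ^ k). split; [|split; [|split; [|split]]].
- transitivity (x * x ^ k); [rewrite /x; ring|done].
- transitivity (S1 * (x ^ k * x ^ k)); [ring|by rewrite hxkj].
- exact: hxkj.
- exact: hKxj.
- exists ((1 - K * G) * op_geom X R0 St x k).
  rewrite -op_geomE {1}hx. ring.
Qed.

Lemma op_pow_bound (f : alg) : exists rho, Rlt 0 rho /\
  forall i x, norm ((f ^ i) x) <= Rmult (pow rho i) (norm x).
Proof.
case: (linear_norm _ (op_linear X R0 St f)) => rho [rho_pos h].
exists rho; split=> //. elim=> [|i IH] x /=.
- rewrite scal_C1. lra.
- apply: Rle_trans (h _) _. rewrite Rmult_assoc.
  apply: Rmult_le_compat_l; [lra|exact: IH].
Qed.

Lemma op_nonzero (f : alg) : f <> 0 -> exists x, f x <> zero.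
Proof.
move=> hf. apply: NNPP => h. apply: hf. apply: op_eq => x /=. rewrite scal_C0.
apply: NNPP => hx. apply: h. by exists x.
Qed.

(** On the range of [E = 1 - Q] the operator [R = (K - 1) / w] is inverted by
    [Y = - w (1 + K + ... + K^(k - 1)) E], and [M = Y + w E] plays the role of
    the nilpotent [(T - mu) E]. The coefficients are [- Y M^(p - 1 - j)] for
    [j < p], with [p] the nilpotency index of [M], and [J (R J)^(j - p)] from
    [p] on. The relations say that [K - z R] times the Laurent series
    with coefficients [c_j z^(j - p)] is [1]. *)
Lemma laurent_coefficients : exists p (c : nat -> alg),
  (1 <= p)%nat /\ (exists f, c O f <> zero) /\ K * c O = 0 /\
  (forall k, K * c (S k) - R * c k = if Nat.eqb (S k) p then 1 else 0) /\
  (forall k, (k < p)%nat -> exists F : alg, c k = P * F) /\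
  (exists b rho, Rlt 0 rho /\
    forall i x, norm (c (p + i)%nat x) <= Rmult (Rmult b (pow rho i)) (norm x)).
Proof.
case: fitting_projection => k [Q [J [hKJ [hQJ [hQQ [hKQ [F hF]]]]]]].
pose E := 1 - Q.
have hEE : E * E = E.
  rewrite /E. transitivity (1 - Q - Q + Q * Q); [ring|rewrite hQQ; ring].
have hKE : K ^ k * E = 0.
  rewrite /E. transitivity (K ^ k - K ^ k * Q); [ring|rewrite hKQ; ring].
pose Y := - (W * op_geom X R0 St K k * E).
have hRY : R * Y = E.
  rewrite R_of_K /Y.
  transitivity (W * W' * ((1 - K) * op_geom X R0 St K k) * E); first ring.
  rewrite W_inv op_geomE. transitivity (E - K ^ k * E); [ring|rewrite hKE; ring].
pose M := Y + W * E.
have hKY : K * Y = M.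
  rewrite /M -hRY /K. ring.
have hEY : E * Y = Y.
  rewrite /Y. transitivity (- (W * op_geom X R0 St K k * (E * E))); [ring|by rewrite hEE].
have hEM : E * M = M.
  rewrite /M. transitivity (E * Y + W * (E * E)); [ring|by rewrite hEE hEY].
have hRM : R * M = K * E.
  rewrite -hKY. transitivity (K * (R * Y)); [ring|by rewrite hRY].
have hRMn : forall j, R ^ j * (M ^ j * E) = K ^ j * E.
  elim=> [|j IH] /=; first ring.
  transitivity (R ^ j * (M ^ j * E) * (R * M)); first ring.
  rewrite IH hRM. transitivity (K * K ^ j * (E * E)); [ring|by rewrite hEE].
have hMk : M ^ k * E = 0.
  by apply: (R_pow_cancel _ k); rewrite hRMn.
have hE0 : E <> 0.
  move=> h. case: K_ker => u [hu hKu]. apply: hu.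
  have -> : u = (J * K + E) u.
    have -> : J * K + E = 1 by rewrite /E -hKJ; ring.
    by rewrite /= scal_C1.
  have -> : J * K + E = J * K by rewrite h; ring.
  change (J (K u) = zero). by rewrite hKu op_zero.
case: (least_witness (fun j => M ^ j * E = 0) k hMk) => p [hMp hmin].
have hp : (1 <= p)%nat.
  case: p hMp {hmin} => [|p] hMp; last lia.
  case: hE0. rewrite -hMp /=. ring.
have hYP : exists F' : alg, Y = P * F'.
  exists (- (W * op_geom X R0 St K k * F)). rewrite /Y /E hF. ring.
case: hYP => F' hYP.
exists p, (fun j => if Nat.ltb j p then - (Y * M ^ (p - 1 - j)) else J * (R * J) ^ (j - p)).
split; [by []|split; [|split; [|split; [|split]]]].
- have hlt : Nat.ltb O p = true by apply/Nat.ltb_lt; lia.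
  rewrite hlt. apply: op_nonzero => h.
  apply: (hmin (p - 1 - O)%nat); first lia.
  transitivity (- (R * (- (Y * M ^ (p - 1 - O))))); last by rewrite h; ring.
  transitivity (R * Y * M ^ (p - 1 - O)); [rewrite hRY; ring|ring].
- have hlt : Nat.ltb O p = true by apply/Nat.ltb_lt; lia.
  rewrite hlt. transitivity (- (K * Y * M ^ (p - 1 - O))); first ring.
  rewrite hKY. have hp1 : p = S (p - 1 - O)%nat by lia.
  have : E * (M * M ^ (p - 1 - O)) = 0.
    move: hMp. rewrite {1}hp1 /= => <-. ring.
  have -> : E * (M * M ^ (p - 1 - O)) = E * M * M ^ (p - 1 - O) by ring.
  rewrite hEM => ->. ring.
- move=> j. case: (Nat.eqb_spec (S j) p) => [hj|hj].
  + have -> : Nat.ltb (S j) p = false by apply/Nat.ltb_ge; lia.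
    have -> : Nat.ltb j p = true by apply/Nat.ltb_lt; lia.
    have -> : (S j - p = 0)%nat by lia.
    have -> : (p - 1 - j = 0)%nat by lia.
    rewrite /=. transitivity (K * J + R * Y); first ring.
    rewrite hKJ hRY /E. ring.
  + case: (Nat.ltb_spec0 (S j) p) => h1.
    * have -> : Nat.ltb j p = true by apply/Nat.ltb_lt; lia.
      have -> : (p - 1 - j = S (p - 1 - S j))%nat by lia.
      move: (p - 1 - S j)%nat => m /=.
      transitivity (- (K * Y) * M ^ m + (R * Y) * M * M ^ m); first ring.
      rewrite hKY hRY hEM. ring.
    * have -> : Nat.ltb j p = false by apply/Nat.ltb_ge; lia.
      have -> : (S j - p = S (j - p))%nat by lia.
      move: (j - p)%nat => m /=.
      transitivity ((K * J) * J * R * (R * J) ^ m - R * J * (R * J) ^ m); first ring.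
      rewrite hKJ hQJ. ring.
- move=> j hj. have -> : Nat.ltb j p = true by apply/Nat.ltb_lt.
  exists (- (F' * M ^ (p - 1 - j))). rewrite hYP. ring.
- case: (linear_norm _ (op_linear X R0 St J)) => b [b_pos hb].
  case: (op_pow_bound (R * J)) => rho [rho_pos hrho].
  exists b, rho; split=> // i x.
  have -> : Nat.ltb (p + i) p = false by apply/Nat.ltb_ge; lia.
  have -> : (p + i - p)%nat = i by lia.
  apply: Rle_trans (hb _) _. rewrite Rmult_assoc.
  apply: Rmult_le_compat_l; [lra|exact: hrho].
Qed.

End LaurentCoefficients.

(** * Resolvents *)

Section Resolvents.
Context (X : HilbertSpace) (T : operator X) (hT : linear_op T).
Add Ring sz_ring_resolvents : (sz_ring X).

Lemma resolvent_unique l u f : resolvent_set T l -> dom T u ->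
  minus (T u) (scal l u) = f -> resolvent T l f = u.
Proof.
move=> [S [hS [h1 h2]]] hu hf.
have uniq : forall v, dom T v /\ minus (T v) (scal l v) = f -> v = S f.
  by move=> v [hv <-]; rewrite h2.
have [h3 h4] : dom T (resolvent T l f) /\
    minus (T (resolvent T l f)) (scal l (resolvent T l f)) = f.
  apply: (iota_correct (fun u : X => dom T u /\ minus (T u) (scal l u) = f)).
  exists (S f). split; first exact: h1.
  by move=> v hv; rewrite (uniq v hv).
rewrite (uniq u (conj hu hf)). exact: uniq (conj h3 h4).
Qed.

Lemma resolvent_spec l f : resolvent_set T l ->
  dom T (resolvent T l f) /\
  T (resolvent T l f) = plus f (scal l (resolvent T l f)).
Proof.
move=> h. case: (h) => S [hS [h1 h2]]. case: (h1 f) => hd he.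
rewrite (resolvent_unique l (S f) f) //. split=> //.
rewrite -{2}he. vec.
Qed.

Lemma resolvent_linear l : resolvent_set T l -> is_linear (resolvent T l).
Proof.
move=> h. case: (h) => S [hS [h1 h2]].
apply: (is_linear_ext S) => // f. case: (h1 f) => hd he. by rewrite (resolvent_unique l (S f) f).
Qed.

Lemma resolvent_identity l l' f : resolvent_set T l -> resolvent_set T l' ->
  resolvent T l f =
  resolvent T l' (plus f (scal (l - l')%C (resolvent T l f))).
Proof.
move=> h h'. symmetry. case: (resolvent_spec l f h) => hd he.
apply: resolvent_unique => //. rewrite he. vec.
Qed.

Lemma resolvent_injective l f : resolvent_set T l -> resolvent T l f = zero -> f = zero.
Proof.
move=> h hf. case: (resolvent_spec l f h) => _. rewrite hf => e.
have -> : f = plus f (scal l zero) by vec.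
rewrite -e. have -> : zero = scal (RtoC 0) zero :> X by vec.
rewrite (proj2 (proj2 hT)); last exact: (proj1 (proj1 hT)). vec.
Qed.

Lemma resolvent_comm l l' f : resolvent_set T l -> resolvent_set T l' ->
  resolvent T l (resolvent T l' f) = resolvent T l' (resolvent T l f).
Proof.
move=> h h'. case: (resolvent_spec l f h) => hd he.
case: (resolvent_spec l' (resolvent T l f) h') => hd1 he1.
have hd2 : dom T (T (resolvent T l' (resolvent T l f))).
  rewrite he1. apply: (proj1 (proj2 (proj1 hT))) => //. exact: (proj2 (proj2 (proj1 hT))).
apply: resolvent_unique => //.
symmetry. apply: resolvent_unique => //.
  apply: subspace_minus => //; [exact: (proj1 hT)|exact: (proj2 (proj2 (proj1 hT)))].
have hTp := proj1 (proj2 hT). have hTs := proj2 (proj2 hT).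
have hsub := proj2 (proj2 (proj1 hT)).
rewrite he1 /minus -scal_opp_l. rewrite !hTp ?hTs //; try exact: hsub.
- rewrite he1 he. vec.
- apply: (proj1 (proj2 (proj1 hT))) => //. exact: hsub.
Qed.

(** By the resolvent identity [R(l') - R(l) = (l' - l) R(l) R(l')], the norm of
    [R(l')] at most doubles as long as [|l' - l|] times the norm of [R(l)] is at
    most one half. *)
Lemma resolvent_locally_bounded l : resolvent_set T l ->
  exists d b, 0 < d /\ 0 < b /\ forall l' f, resolvent_set T l' -> Cmod (l' - l) < d ->
    norm (resolvent T l' f) <= b * norm f /\
    norm (minus (resolvent T l' f) (resolvent T l f)) <= Cmod (l' - l) * b * norm f.
Proof.
move=> h. case: (linear_norm _ (resolvent_linear l h)) => m [m_pos hm].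
exists (/ (2 * m)), (2 * m * (m + 1)). split; first by apply: Rinv_0_lt_compat; lra.
split; first by apply: Rmult_lt_0_compat; lra.
move=> l' f h' hd.
have e : minus (resolvent T l' f) (resolvent T l f) =
    scal (l' - l)%C (resolvent T l (resolvent T l' f)).
  rewrite {1}(resolvent_identity l' l f h' h) linear_plus; last exact: resolvent_linear.
  rewrite linear_scal; last exact: resolvent_linear. vec.
have n1 : norm (minus (resolvent T l' f) (resolvent T l f)) <=
    Cmod (l' - l) * (m * norm (resolvent T l' f)).
  rewrite e. apply: Rle_trans (norm_scal _ _) _.
  apply: Rmult_le_compat_l; [exact: Cmod_ge_0|exact: hm].
have c0 := Cmod_ge_0 (l' - l).
have n0 := norm_ge_0 (resolvent T l' f).
have f0 := norm_ge_0 f.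
have hdm : Cmod (l' - l) * m <= / 2.
  have -> : / 2 = / (2 * m) * m by field; lra.
  apply: Rmult_le_compat_r; lra.
have n2 : norm (resolvent T l' f) <= 2 * m * norm f.
  have tri := norm_triangle (minus (resolvent T l' f) (resolvent T l f)) (resolvent T l f).
  have e2 : plus (minus (resolvent T l' f) (resolvent T l f)) (resolvent T l f)
    = resolvent T l' f by vec.
  rewrite e2 in tri. have := hm f. nra.
have mm : 0 <= m * m by nra.
split.
- apply: Rle_trans n2 _. nra.
- apply: Rle_trans n1 _. rewrite Rmult_assoc. apply: Rmult_le_compat_l => //. nra.
Qed.
End Resolvents.

(** * Integrals of the resolvent over a circle *)

(** A bounded operator passes through the Riemann sums. *)
Lemma is_RInt_linear (X Y : HilbertSpace) (L : X -> Y) (g : R -> X) (a b : R) (v : X) :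
  is_linear L ->
  is_RInt (V := restrict_scalars X) g a b v ->
  is_RInt (V := restrict_scalars Y) (fun t => L (g t)) a b (L v).
Proof.
move=> hL hg.
have hsum : forall ptd, Riemann_sum (V := restrict_scalars Y) (fun t => L (g t)) ptd =
    L (Riemann_sum (V := restrict_scalars X) g ptd).
  apply: SF_cons_ind => [x|h ptd IH].
  - rewrite /Riemann_sum /=. symmetry. exact: (linear_zero L).
  - rewrite !Riemann_sum_cons IH.
    rewrite (linear_plus L hL). congr plus. symmetry. exact: (linear_scal L hL).
rewrite /is_RInt.
apply: (filterlim_ext (fun ptd => L (scal (V := restrict_scalars X) (sign (b - a))
    (Riemann_sum (V := restrict_scalars X) g ptd)))).
  move=> ptd. rewrite hsum. exact: (linear_scal L hL).
apply: (filterlim_comp _ _ _ _ L _ (locally (v : X)) _ hg).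
exact: (linear_cont L).
Qed.

Section CircleIntegrals.
Context (X : HilbertSpace) (T : operator X) (hT : linear_op T) (mu : C) (r : R)
  (r_pos : 0 < r)
  (hr : forall l : C, 0 < Cmod (l - mu) <= r -> resolvent_set T l).
Add Ring sz_ring_circle : (sz_ring X).

Lemma Cmod_cis t : Cmod (cis t) = 1.
Proof.
rewrite /Cmod /cis /=. rewrite -[RHS]sqrt_1. congr sqrt.
have := sin2_cos2 t. rewrite /Rsqr. lra.
Qed.

Lemma cis_continuous t eps : 0 < eps ->
  exists d, 0 < d /\ forall s, Rabs (s - t) < d -> Cmod (cis s - cis t) < eps.
Proof.
move=> he.
have e2 : 0 < eps / 2 by lra.
case: (proj1 (continuity_pt_locally cos t) (continuity_cos t) (mkposreal _ e2)) => d1 h1.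
case: (proj1 (continuity_pt_locally sin t) (continuity_sin t) (mkposreal _ e2)) => d2 h2.
exists (Rmin d1 d2). split.
  apply: Rmin_glb_lt; apply: cond_pos.
move=> s hs.
have hs1 : Rabs (cos s - cos t) < eps / 2.
  apply: h1. apply: Rlt_le_trans hs (Rmin_l _ _).
have hs2 : Rabs (sin s - sin t) < eps / 2.
  apply: h2. apply: Rlt_le_trans hs (Rmin_r _ _).
have -> : (cis s - cis t)%C = (RtoC (cos s - cos t) + Ci * RtoC (sin s - sin t))%C.
  rewrite /cis /Ci /RtoC. apply: injective_projections => /=; ring.
apply: Rle_lt_trans (Cmod_triangle _ _) _.
rewrite Cmod_mult !Cmod_R.
rewrite Cmod_Ci. lra.
Qed.

Let circ (t : R) : C := (mu + r * cis t)%C.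

Lemma circ_resolvent t : resolvent_set T (circ t).
Proof.
apply: hr. have -> : (circ t - mu = r * cis t)%C by rewrite /circ; ring.
rewrite Cmod_mult Cmod_cis Cmod_R Rabs_pos_eq; lra.
Qed.

Lemma circ_dist s t : Cmod (circ s - circ t) = r * Cmod (cis s - cis t).
Proof.
have -> : (circ s - circ t = r * (cis s - cis t))%C by rewrite /circ; ring.
by rewrite Cmod_mult Cmod_R Rabs_pos_eq; [|lra].
Qed.

Lemma circ_locally_bounded t : exists d b, 0 < d /\ 0 < b /\ forall s f,
  Rabs (s - t) < d -> norm (resolvent T (circ s) f) <= b * norm f.
Proof.
case: (resolvent_locally_bounded X T (circ t) (circ_resolvent t)) => d [b [hd [hb h]]].
have hdr : 0 < d / r by apply: Rdiv_lt_0_compat.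
case: (cis_continuous t (d / r) hdr) => d' [hd' h'].
exists d', b; split; [by []|split; [by []|]] => s f hs.
apply: (proj1 (h _ f (circ_resolvent s) _)).
rewrite circ_dist. have := h' s hs => hc.
have -> : d = r * (d / r) by field; lra.
exact: Rmult_lt_compat_l.
Qed.

(** Compactness of the parameter interval, with the local bounds encoded in the
    radii: shrinking the radius at [t] below the inverse of the bound there,
    a positive lower bound of the radii of a cover is also a bound of the
    resolvent. *)
Lemma circ_bounded : exists b, 0 < b /\ forall t f, 0 <= t <= 2 * PI ->
  norm (resolvent T (circ t) f) <= b * norm f.
Proof.
have hloc : forall t, exists d : posreal, forall s f,
    Rabs (s - t) < d -> norm (resolvent T (circ s) f) <= / d * norm f.
  move=> t. case: (circ_locally_bounded t) => d [b [hd [hb h]]].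
  have hpos : 0 < Rmin d (/ b).
    apply: Rmin_glb_lt => //. exact: Rinv_0_lt_compat.
  exists (mkposreal _ hpos) => s f /= hs.
  apply: Rle_trans (h s f _) _.
    apply: Rlt_le_trans hs (Rmin_l _ _).
  apply: Rmult_le_compat_r; first exact: norm_ge_0.
  rewrite -{1}(Rinv_inv b). apply: Rinv_le_contravar => //. exact: Rmin_r.
case: (choice _ hloc) => delta hdelta.
case: (compactness_value_1d 0 (2 * PI) delta) => d hd.
exists (/ d). split; first by apply: Rinv_0_lt_compat; exact: cond_pos.
move=> t f ht. apply: NNPP => hn. apply: (hd t ht) => [[s [hs [hst hds]]]]. apply: hn.
apply: Rle_trans (hdelta s t f hst) _.
apply: Rmult_le_compat_r; first exact: norm_ge_0.
apply: Rinv_le_contravar => //. exact: cond_pos.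
Qed.

Lemma circ_resolvent_continuous f t :
  continuous (U := restrict_scalars X) (fun s => resolvent T (circ s) f) t.
Proof.
case: (resolvent_locally_bounded X T (circ t) (circ_resolvent t)) => d [b [hd [hb h]]].
move=> Q [eps hQ].
have nf := norm_ge_0 f.
have hc : 0 < r * b * (norm f + 1) by apply: Rmult_lt_0_compat; [apply: Rmult_lt_0_compat|]; lra.
have hm : 0 < Rmin (d / r) (eps / (r * b * (norm f + 1))).
  apply: Rmin_glb_lt; apply: Rdiv_lt_0_compat => //. exact: cond_pos.
case: (cis_continuous t _ hm) => d' [hd' h'].
exists (mkposreal _ hd') => s hs. apply: hQ.
have hs' : Cmod (cis s - cis t) < Rmin (d / r) (eps / (r * b * (norm f + 1))).
  exact: h'.
apply: (@norm_compat1 C_AbsRing X).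
have e1 : Cmod (circ s - circ t) < d.
  rewrite circ_dist. have -> : d = r * (d / r) by field; lra.
  apply: Rmult_lt_compat_l => //. exact: Rlt_le_trans hs' (Rmin_l _ _).
apply: Rle_lt_trans (proj2 (h _ f (circ_resolvent s) e1)) _.
rewrite circ_dist.
have e2 : Cmod (cis s - cis t) < eps / (r * b * (norm f + 1)).
  exact: Rlt_le_trans hs' (Rmin_r _ _).
have -> : r * Cmod (cis s - cis t) * b * norm f = Cmod (cis s - cis t) * (r * b * norm f) by ring.
apply: Rle_lt_trans (_ : _ <= Cmod (cis s - cis t) * (r * b * (norm f + 1))) _.
  apply: Rmult_le_compat_l; first exact: Cmod_ge_0. apply: Rmult_le_compat_l; nra.
have -> : pos eps = eps / (r * b * (norm f + 1)) * (r * b * (norm f + 1)) by field; lra.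
exact: Rmult_lt_compat_r.
Qed.

Lemma cis_scal_continuous (g : R -> X) t : 
  continuous (U := restrict_scalars X) g t ->
  continuous (U := restrict_scalars X) (fun s => scal (cis s) (g s)) t.
Proof.
move=> hg.
apply: (@continuous_scal _ C_AbsRing X cis g t) => //.
move=> Q [eps hQ].
case: (cis_continuous t eps (cond_pos eps)) => d [hd h].
exists (mkposreal _ hd) => s hs. apply: hQ. exact: h.
Qed.
Let I (g : R -> X) : X := RInt (V := restrict_scalars X) g 0 (2 * PI).

Lemma circle_integral_correct (g : R -> X) :
  (forall t, continuous (U := restrict_scalars X) g t) ->
  is_RInt (V := restrict_scalars X) g 0 (2 * PI) (I g).
Proof.
move=> hg. apply: RInt_correct. by apply: ex_RInt_continuous => t _.
Qed.

Lemma circle_integral_unique (g : R -> X) v :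
  is_RInt (V := restrict_scalars X) g 0 (2 * PI) v -> I g = v.
Proof. exact: (@is_RInt_unique (restrict_scalars X)). Qed.

Lemma circle_integral_op (L : X -> X) (g : R -> X) : is_linear L ->
  (forall t, continuous (U := restrict_scalars X) g t) ->
  I (fun t => L (g t)) = L (I g).
Proof.
move=> hL hg. apply: circle_integral_unique. apply: is_RInt_linear => //.
exact: circle_integral_correct.
Qed.

Lemma circle_integral_linear (g : X -> R -> X) b : 0 < b ->
  (forall f t, continuous (U := restrict_scalars X) (g f) t) ->
  (forall f h t, g (plus f h) t = plus (g f t) (g h t)) ->
  (forall c f t, g (scal c f) t = scal c (g f t)) ->
  (forall f t, 0 <= t <= 2 * PI -> norm (g f t) <= b * norm f) ->
  is_linear (fun f => I (g f)).
Proof.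
move=> hb hc hp hs hn.
have hpi := PI_RGT_0.
have hI := fun f => circle_integral_correct (g f) (hc f).
split.
- move=> f h. apply: circle_integral_unique.
  apply: (@is_RInt_ext (restrict_scalars X) (fun t => plus (g f t) (g h t))) => [t _|]; first by rewrite hp.
  exact: (@is_RInt_plus (restrict_scalars X) _ _ _ _ _ _ (hI f) (hI h)).
- move=> c f. apply: circle_integral_unique.
  apply: (@is_RInt_ext (restrict_scalars X) (fun t => scal c (g f t))) => [t _|]; first by rewrite hs.
  apply: (is_RInt_linear _ _ (fun x => scal c x)) (hI f). exact: is_linear_scal_C.
- exists (2 * PI * b). split; first by apply: Rmult_lt_0_compat; lra.
  move=> f. have -> : 2 * PI * b * norm f = (2 * PI - 0) * (b * norm f) by ring.
  apply: (@norm_RInt_le_const (restrict_scalars X) (g f) 0 (2 * PI) (I (g f)) (b * norm f)) => [| |]; [lra| |exact: hI].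
  exact: hn.
Qed.

(* [S0] is the integral of [R(l) / (l - mu)] over the circle, up to the factor
   [2 pi i]; in the parameter [t] the factor [l - mu] cancels against [dl]. *)
Let g1 (f : X) (t : R) : X := resolvent T (circ t) f.
Let g2 (f : X) (t : R) : X := scal (Ci * r * cis t)%C (g1 f t).

Lemma g2_continuous f t : continuous (U := restrict_scalars X) (g2 f) t.
Proof.
apply: (continuous_ext (fun s => scal (cis s) (scal (Ci * r)%C (g1 f s)))) => [s|].
  rewrite /g2 scal_assoc. congr scal. exact: Cmult_comm.
apply: cis_scal_continuous.
apply: (@continuous_comp R_UniformSpace (restrict_scalars X) (restrict_scalars X)
  (g1 f) (fun x : X => scal (Ci * r)%C x)).
- exact: circ_resolvent_continuous.
- apply: (linear_cont (fun x : X => scal (Ci * r)%C x)). exact: is_linear_scal_C.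
Qed.

Lemma g1_linear_t t : is_linear (fun f => g1 f t).
Proof. apply: resolvent_linear. exact: circ_resolvent. Qed.

Lemma g1_integral_linear : is_linear (fun f => I (g1 f)).
Proof.
case: circ_bounded => b [hb hn].
apply: (circle_integral_linear g1 b hb).
- move=> f t. exact: circ_resolvent_continuous.
- move=> f h t. exact: (linear_plus _ (g1_linear_t t)).
- move=> c f t. exact: (linear_scal _ (g1_linear_t t)).
- move=> f t ht. exact: hn.
Qed.

Lemma g2_integral_linear : is_linear (fun f => I (g2 f)).
Proof.
case: circ_bounded => b [hb hn].
apply: (circle_integral_linear g2 (r * b)).
- exact: Rmult_lt_0_compat.
- exact: g2_continuous.
- move=> f h t. rewrite /g2 (linear_plus _ (g1_linear_t t)). vec.
- move=> c f t. rewrite /g2 (linear_scal _ (g1_linear_t t)). vec.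
- move=> f t ht. apply: Rle_trans (norm_scal _ _) _.
  rewrite /abs /= !Cmod_mult Cmod_Ci Cmod_cis Cmod_R Rabs_pos_eq; last lra.
  rewrite Rmult_1_l Rmult_1_r Rmult_assoc. apply: Rmult_le_compat_l; [lra|exact: hn].
Qed.

Let w : C := (r * cis 0)%C.
Let R0 : X -> X := resolvent T (circ 0).
Let P : X -> X := riesz_projection T mu r.
Let S0 (f : X) : X := scal (/ (2 * PI))%C (I (g1 f)).

Lemma riesz_projectionE f : P f = scal (- / (2 * PI * Ci))%C (I (g2 f)).
Proof. by []. Qed.

Lemma R0_linear : is_linear R0.
Proof. apply: resolvent_linear. exact: circ_resolvent. Qed.

Lemma R0_S0 f : R0 (S0 f) = S0 (R0 f).
Proof.
rewrite /S0 (linear_scal _ R0_linear). congr scal.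
rewrite -(circle_integral_op R0); first last.
- move=> t. exact: circ_resolvent_continuous.
- exact: R0_linear.
congr I. apply: functional_extensionality => t.
apply: resolvent_comm => //; exact: circ_resolvent.
Qed.

Lemma R0_P f : R0 (P f) = P (R0 f).
Proof.
rewrite !riesz_projectionE (linear_scal _ R0_linear). congr scal.
rewrite -(circle_integral_op R0); first last.
- move=> t. exact: g2_continuous.
- exact: R0_linear.
congr I. apply: functional_extensionality => t.
rewrite /g2 (linear_scal _ R0_linear). congr scal.
apply: resolvent_comm => //; exact: circ_resolvent.
Qed.

(** This is [(T - mu) S0 = 1 - P] seen through the resolvent [R0] at [mu + w]:
    integrate [R(l) f = R0 (f + (l - mu) R(l) f - w R(l) f)] over the circle. *)
Lemma reduced_resolvent_identity f :
  S0 f = R0 (minus (minus f (P f)) (scal w (S0 f))).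
Proof.
have hpi := PI_RGT_0.
have pi0 : RtoC (2 * PI) <> RtoC 0 by move=> /RtoC_inj; lra.
have i0 := Ci_nz.
have h1 : is_RInt (V := restrict_scalars X)
    (fun t => plus (plus f (scal (/ Ci)%C (g2 f t))) (scal (- w)%C (g1 f t))) 0 (2 * PI)
    (plus (plus (scal (RtoC (2 * PI - 0)) f) (scal (/ Ci)%C (I (g2 f))))
      (scal (- w)%C (I (g1 f)))).
  apply: (@is_RInt_plus (restrict_scalars X)).
  - apply: (@is_RInt_plus (restrict_scalars X)).
    + exact: (@is_RInt_const (restrict_scalars X)).
    + apply: (is_RInt_linear _ _ (fun x => scal (/ Ci)%C x)); first exact: is_linear_scal_C.
      apply: circle_integral_correct. exact: g2_continuous.
  - apply: (is_RInt_linear _ _ (fun x => scal (- w)%C x)); first exact: is_linear_scal_C.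
    apply: circle_integral_correct => t. exact: circ_resolvent_continuous.
have h2 := is_RInt_linear _ _ _ _ _ _ _ R0_linear h1.
have h3 : I (g1 f) = R0 (plus (plus (scal (RtoC (2 * PI - 0)) f)
    (scal (/ Ci)%C (I (g2 f)))) (scal (- w)%C (I (g1 f)))).
  apply: circle_integral_unique. move: h2. apply: (@is_RInt_ext (restrict_scalars X)) => t _.
  symmetry. rewrite /g1 {1}(resolvent_identity X T (circ t) (circ 0)); try exact: circ_resolvent.
  rewrite /R0. congr (resolvent _ _ _). rewrite /g2 /g1 /w.
  have e : (circ t - circ 0 = / Ci * (Ci * r * cis t) + - (r * cis 0))%C.
    rewrite /circ !Cmult_assoc Cinv_l //. ring.
  rewrite e. vec.
rewrite /S0 {1}h3 -(linear_scal _ R0_linear). congr R0.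
rewrite riesz_projectionE Rminus_0_r.
rewrite -RtoC_mult.
have e1 : (/ RtoC (2 * PI) * RtoC (2 * PI) = 1)%C by exact: Cinv_l.
have e2 : (- / (RtoC (2 * PI) * Ci) = - (/ RtoC (2 * PI) * / Ci))%C.
  by field; split.
have e3 : scal (/ RtoC (2 * PI))%C (scal (RtoC (2 * PI)) f) = f.
  rewrite scal_assoc -[RHS]scal_C1. congr scal. exact: e1.
rewrite e2 !scal_distr_l e3. vec.
Qed.

(** [S0 (T - mu - w)], written so that it is visibly bounded and everywhere
    defined. *)
Definition reduced_shift (f : X) : X := minus (minus f (P f)) (scal w (S0 f)).

Lemma S0_linear : is_linear S0.
Proof.
apply: (is_linear_comp (fun f => I (g1 f)) (fun x => scal (/ (2 * PI))%C x)).
- exact: g1_integral_linear.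
- exact: is_linear_scal_C.
Qed.

Lemma P_linear : is_linear P.
Proof.
apply: (is_linear_comp (fun f => I (g2 f)) (fun x => scal (- / (2 * PI * Ci))%C x)).
- exact: g2_integral_linear.
- exact: is_linear_scal_C.
Qed.

(** The Riesz projection is [1 - (1 + w R0) St] for bounded commuting [R0] and
    [St]; this is all that the rest of the proof uses of contour integrals. *)
Lemma riesz_complement : exists w St, w <> RtoC 0 /\
  Cmod w <= r /\ is_linear St /\
  (forall f, resolvent T (mu + w)%C (St f) = St (resolvent T (mu + w)%C f)) /\
  forall f, minus f (plus (St f) (scal w (resolvent T (mu + w)%C (St f)))) =
    riesz_projection T mu r f.
Proof.
exists w, reduced_shift.
have mw : Cmod w = r.
  by rewrite /w Cmod_mult Cmod_cis Cmod_R Rabs_pos_eq; [ring|lra].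
split; [|split; [lra|split; [|split]]].
- apply/Cmod_gt_0. lra.
- apply: is_linear_plus_fct.
  + apply: is_linear_plus_fct; first exact: is_linear_id.
    apply: is_linear_comp; [exact: P_linear|exact: is_linear_opp].
  + apply: (is_linear_comp (fun f => scal w (S0 f)) opp); last exact: is_linear_opp.
    apply: (is_linear_comp S0); [exact: S0_linear|exact: is_linear_scal_C].
- move=> f.
  change (R0 (minus (minus f (P f)) (scal w (S0 f))) =
    minus (minus (R0 f) (P (R0 f))) (scal w (S0 (R0 f)))).
  by rewrite -R0_P -R0_S0 !(linear_minus _ _ _ R0_linear) (linear_scal _ R0_linear w).
- move=> f. change (resolvent T (mu + w)%C) with R0.
  rewrite -reduced_resolvent_identity /reduced_shift -/(P f). vec.
Qed.
End CircleIntegrals.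

(** * Orthogonal projection and adjoints *)

Section InnerProduct.
Context (X : HilbertSpace).
Add Ring sz_ring_inner : (sz_ring X).

Lemma inner_plus_r (x y z : X) : inner x (plus y z) = (inner x y + inner x z)%C.
Proof. by rewrite inner_conj inner_plus_l Cplus_conj -!inner_conj. Qed.
Lemma inner_scal_r (a : C) (x y : X) : inner x (scal a y) = (Cconj a * inner x y)%C.
Proof. by rewrite inner_conj inner_scal_l Cmult_conj -inner_conj. Qed.
Lemma inner_opp_l (x y : X) : inner (opp x) y = (- inner x y)%C.
Proof.
have -> : opp x = scal (- (1))%C x by vec.
rewrite inner_scal_l. ring.
Qed.
Lemma inner_opp_r (x y : X) : inner x (opp y) = (- inner x y)%C.
Proof. by rewrite inner_conj inner_opp_l Copp_conj -inner_conj. Qed.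
Lemma inner_minus_l (x y z : X) : inner (minus x y) z = (inner x z - inner y z)%C.
Proof. by rewrite /minus inner_plus_l inner_opp_l. Qed.
Lemma inner_minus_r (x y z : X) : inner x (minus y z) = (inner x y - inner x z)%C.
Proof. by rewrite /minus inner_plus_r inner_opp_r. Qed.
Lemma inner_zero_r (x : X) : inner x zero = RtoC 0.
Proof.
have -> : zero = scal (RtoC 0) x by vec.
rewrite inner_scal_r. have -> : Cconj (RtoC 0) = RtoC 0 by rewrite /Cconj /RtoC /= Ropp_0.
ring.
Qed.

(** The expansion of the square, the source of the parallelogram law and of the
    variational inequality below. *)
Lemma norm_sub_scal (c : C) (u v : X) : norm (minus u (scal c v)) ^ 2 =
  norm u ^ 2 - 2 * Re (Cconj c * inner u v)%C + Cmod c ^ 2 * norm v ^ 2.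
Proof.
have h := inner_norm X (minus u (scal c v)).
rewrite inner_minus_l !inner_minus_r inner_scal_l inner_scal_r inner_scal_l inner_scal_r in h.
rewrite (inner_conj X v u) !inner_norm in h.
have h' := f_equal Re h.
have hc : Cmod c ^ 2 = fst c ^ 2 + snd c ^ 2.
  rewrite /Cmod pow2_sqrt //. nra.
rewrite -[LHS]/(Re (RtoC (norm (minus u (scal c v)) ^ 2))) -h' hc.
case: c {h h' hc} => c1 c2. case: (inner u v) => i1 i2.
rewrite /Re /Cconj /Cmult /Cminus /Cplus /Copp /RtoC /fst /snd. ring.
Qed.

Lemma norm_scal_sq (c : C) (v : X) : norm (scal c v) ^ 2 = Cmod c ^ 2 * norm v ^ 2.
Proof.
have h := norm_sub_scal (- c) zero v.
have e : minus zero (scal (- c)%C v) = scal c v by vec.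
rewrite e in h. rewrite h norm_zero Cmod_opp inner_conj inner_zero_r.
rewrite /Re /Cconj /Cmult /RtoC /=. ring.
Qed.

Lemma parallelogram (u v : X) :
  norm (minus u v) ^ 2 + norm (plus u v) ^ 2 = 2 * norm u ^ 2 + 2 * norm v ^ 2.
Proof.
have h1 := norm_sub_scal (RtoC 1) u v. have h2 := norm_sub_scal (RtoC (-1)) u v.
have e1 : minus u (scal (RtoC 1) v) = minus u v by vec.
have e2 : minus u (scal (RtoC (-1)) v) = plus u v.
  have -> : RtoC (-1) = (- RtoC 1)%C by rewrite -RtoC_opp. vec.
rewrite e1 in h1. rewrite e2 in h2. rewrite h1 h2 !Cmod_R Rabs_R1.
have -> : Rabs (-1) = 1 by rewrite Rabs_Ropp Rabs_R1.
case: (inner u v) => i1 i2. rewrite /Re /Cconj /Cmult /RtoC /=. ring.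
Qed.

Lemma norm_zero_eq (x : X) : norm x ^ 2 <= 0 -> x = zero.
Proof. move=> h. apply: norm_eq_zero. have := norm_ge_0 x. nra. Qed.

Lemma orthogonal_to_dense (D : X -> Prop) (z : X) :
  (forall (x : X) (eps : R), 0 < eps -> exists u, D u /\ norm (minus u x) < eps) ->
  (forall u, D u -> inner u z = RtoC 0) -> z = zero.
Proof.
move=> hD hz. apply: NNPP => hn.
have nz : 0 < norm z.
  case: (norm_ge_0 z) => // h. case: hn. exact: norm_eq_zero.
case: (hD z (norm z) nz) => u [hu hd].
have h := norm_sub_scal (RtoC 1) u z.
have e1 : minus u (scal (RtoC 1) z) = minus u z by vec.
rewrite e1 (hz u hu) Cmod_R Rabs_R1 in h.
have e2 : Re (Cconj 1 * 0)%C = 0 by rewrite /Re /Cconj /Cmult /RtoC /=; ring.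
rewrite e2 in h. have := norm_ge_0 (minus u z). have := norm_ge_0 u. nra.
Qed.
End InnerProduct.

(** The projection theorem is needed on graphs of operators, hence for closed
    subspaces [Gr] of [X * X]; subspaces of [X] are those with second
    component zero. *)
Section Projection.
Context (X : HilbertSpace) (Gr : X -> X -> Prop).
Add Ring sz_ring_projection : (sz_ring X).
Context (Gr0 : Gr zero zero)
  (Gr_plus : forall x y x' y', Gr x y -> Gr x' y' -> Gr (plus x x') (plus y y'))
  (Gr_scal : forall c x y, Gr x y -> Gr (scal c x) (scal c y))
  (Gr_closed : forall x y : X, (forall eps, 0 < eps -> exists x' y', Gr x' y' /\
     norm (minus x' x) < eps /\ norm (minus y' y) < eps) -> Gr x y).
Context (a b : X).

Let q (x y : X) : R := norm (minus a x) ^ 2 + norm (minus b y) ^ 2.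

Lemma distance_infimum : exists d, (forall x y, Gr x y -> d <= q x y) /\
  forall eps, 0 < eps -> exists x y, Gr x y /\ q x y < d + eps.
Proof.
case: (completeness (fun t => exists x y, Gr x y /\ t = - q x y)).
- exists 0 => t [x [y [_ ->]]]. rewrite /q.
  have := pow2_ge_0 (norm (minus a x)). have := pow2_ge_0 (norm (minus b y)). lra.
- by exists (- q zero zero), zero, zero.
- move=> m [hub hlub]. exists (- m). split.
  + move=> x y hxy. have : - q x y <= m by apply: hub; exists x, y. lra.
  + move=> eps he. apply: NNPP => hn.
    have : m <= m - eps.
      apply: hlub => t [x [y [hxy ->]]]. apply: Rnot_lt_le => hlt.
      apply: hn. exists x, y. split=> //. lra.
    lra.
Qed.

(** The parallelogram law for the two residuals: a minimising sequence is
    Cauchy. *)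
Lemma midpoint_identity (x y x' y' : X) :
  norm (minus x x') ^ 2 + norm (minus y y') ^ 2 = 2 * q x y + 2 * q x' y' -
    4 * q (scal (RtoC (/ 2)) (plus x x')) (scal (RtoC (/ 2)) (plus y y')).
Proof.
have key : forall c u u' : X, norm (minus u u') ^ 2 = 2 * norm (minus c u) ^ 2 +
    2 * norm (minus c u') ^ 2 - 4 * norm (minus c (scal (RtoC (/ 2)) (plus u u'))) ^ 2.
  move=> c u u'. have h := parallelogram X (minus c u') (minus c u).
  have e1 : minus (minus c u') (minus c u) = minus u u' by vec.
  have e2 : plus (minus c u') (minus c u) =
      scal (RtoC 2) (minus c (scal (RtoC (/ 2)) (plus u u'))).
    have hh : (RtoC 2 * RtoC (/ 2) = 1)%C by rewrite -RtoC_mult; congr RtoC; field.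
    transitivity (minus (scal (RtoC 2) c) (scal (RtoC 2 * RtoC (/ 2))%C (plus u u'))); last vec.
    rewrite hh. have -> : RtoC 2 = (1 + 1)%C by rewrite -RtoC_plus. vec.
  rewrite e1 e2 norm_scal_sq Cmod_R in h.
  have h2 : Rabs 2 = 2 by rewrite Rabs_pos_eq; lra.
  rewrite h2 in h. lra.
rewrite /q (key a x x') (key b y y'). ring.
Qed.

Lemma seq_cauchy_limit (u : nat -> X) :
  (forall eps, 0 < eps -> exists N, forall n m, (N <= n)%nat -> (N <= m)%nat ->
     norm (minus (u n) (u m)) < eps) ->
  exists x, forall eps, 0 < eps -> exists N, forall n, (N <= n)%nat ->
     norm (minus (u n) x) < eps.
Proof.
move=> h.
case: (proj1 (filterlim_locally_cauchy (U := X) (F := eventually) u)).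
- move=> eps. case: (h eps (cond_pos eps)) => N hN.
  exists (fun n => (N <= n)%nat). split; first by exists N.
  move=> n m hn hm. apply: (@norm_compat1 C_AbsRing X). exact: hN.
- move=> x hx. exists x => eps he.
  have hf := @norm_factor_gt_0 C_AbsRing X.
  have he' : 0 < eps / @norm_factor C_AbsRing X by apply: Rdiv_lt_0_compat.
  case: (proj1 (filterlim_locally u x) hx (mkposreal _ he')) => N hN.
  exists N => n hn. have := @norm_compat2 C_AbsRing X _ _ _ (hN n hn).
  rewrite /=.
  have -> : @norm_factor C_AbsRing X * (eps / @norm_factor C_AbsRing X) = eps by field; lra.
  by [].
Qed.

Lemma nearest_point : exists x y, Gr x y /\ forall x' y', Gr x' y' -> q x y <= q x' y'.
Proof.
case: distance_infimum => d [hd hinf].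
have hpos : forall n, 0 < / (INR n + 1).
  move=> n. apply: Rinv_0_lt_compat. have := pos_INR n. lra.
have hsmall : forall eps, 0 < eps -> exists N, forall n, (N <= n)%nat -> / (INR n + 1) < eps.
  move=> eps he. case: (nfloor_ex (/ eps)) => [|N [_ hN]].
    left. exact: Rinv_0_lt_compat.
  exists N => n hn. rewrite -(Rinv_inv eps). apply: Rinv_lt_contravar.
    apply: Rmult_lt_0_compat; first exact: Rinv_0_lt_compat.
    have := pos_INR n. lra.
  apply: Rlt_le_trans hN _. have := le_INR _ _ hn. lra.
have hex : forall n, exists p : X * X, Gr (fst p) (snd p) /\
    q (fst p) (snd p) < d + / (INR n + 1).
  move=> n. case: (hinf _ (hpos n)) => x [y hxy]. by exists (x, y).
case: (choice _ hex) => p hp.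
have hcau : forall eps, 0 < eps -> exists N, forall n m, (N <= n)%nat -> (N <= m)%nat ->
    norm (minus (fst (p n)) (fst (p m))) ^ 2 + norm (minus (snd (p n)) (snd (p m))) ^ 2
      < eps ^ 2.
  move=> eps he. case: (hsmall (eps ^ 2 / 4)) => [|N hN].
    have := pow_lt eps 2 he. lra.
  exists N => n m hn hm. rewrite midpoint_identity.
  have hmid : d <= q (scal (RtoC (/ 2)) (plus (fst (p n)) (fst (p m))))
      (scal (RtoC (/ 2)) (plus (snd (p n)) (snd (p m)))).
    apply: hd. apply: Gr_scal. apply: Gr_plus; exact: (proj1 (hp _)).
  have := proj2 (hp n). have := proj2 (hp m). have := hN n hn. have := hN m hm. lra.
have sq_lt : forall s t eps, 0 < eps -> s ^ 2 + t ^ 2 < eps ^ 2 -> s < eps /\ t < eps.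
  move=> s t eps he h. split; apply: Rnot_le_lt => hle; nra.
case: (seq_cauchy_limit (fun n => fst (p n))) => [eps he|x hx].
  case: (hcau eps he) => N hN. exists N => n m hn hm.
  exact: (proj1 (sq_lt _ _ _ he (hN n m hn hm))).
case: (seq_cauchy_limit (fun n => snd (p n))) => [eps he|y hy].
  case: (hcau eps he) => N hN. exists N => n m hn hm.
  exact: (proj2 (sq_lt _ _ _ he (hN n m hn hm))).
exists x, y. split.
- apply: Gr_closed => eps he. case: (hx eps he) => N1 h1. case: (hy eps he) => N2 h2.
  exists (fst (p (N1 + N2)%nat)), (snd (p (N1 + N2)%nat)).
  split; [exact: (proj1 (hp _))|split; [apply: h1|apply: h2]; lia].
- have hle : q x y <= d.
    have hlim : forall (c z : X) (u : nat -> X),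
        (forall eps, 0 < eps -> exists N, forall n, (N <= n)%nat -> norm (minus (u n) z) < eps) ->
        is_lim_seq (fun n => norm (minus c (u n)) ^ 2) (norm (minus c z) ^ 2).
      move=> c z u hu.
      have h1 : is_lim_seq (fun n => norm (minus c (u n))) (norm (minus c z)).
        apply/is_lim_seq_spec => eps. case: (hu eps (cond_pos eps)) => N hN.
        exists N => n hn. apply: Rle_lt_trans (norm_triangle_inv _ _) _.
        have -> : minus (minus c (u n)) (minus c z) = opp (minus (u n) z) by vec.
        rewrite norm_opp. exact: hN.
      apply: (is_lim_seq_ext (fun n => norm (minus c (u n)) * norm (minus c (u n)))).
        by move=> n; ring.
      have -> : norm (minus c z) ^ 2 = norm (minus c z) * norm (minus c z) by ring.
      exact: is_lim_seq_mult'.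
    apply: (is_lim_seq_le (fun n => q (fst (p n)) (snd (p n))) (fun n => d + / (INR n + 1))
      (q x y) d).
    + move=> n. left. exact: (proj2 (hp n)).
    + apply: is_lim_seq_plus'; exact: hlim.
    + apply/is_lim_seq_spec => eps. case: (hsmall eps (cond_pos eps)) => N hN.
      exists N => n hn. have -> : d + / (INR n + 1) - d = / (INR n + 1) by ring.
      rewrite Rabs_pos_eq; [exact: hN|left; exact: hpos].
  move=> x' y' h'. apply: Rle_trans hle _. exact: hd.
Qed.

Lemma projection : exists x y, Gr x y /\ forall x' y', Gr x' y' ->
  (inner (minus a x) x' + inner (minus b y) y')%C = RtoC 0.
Proof.
case: nearest_point => x [y [hxy hmin]]. exists x, y. split=> // x' y' h'.
set s := (_ + _)%C.
set n2 := norm x' ^ 2 + norm y' ^ 2.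
have n2_pos : 0 <= n2.
  rewrite /n2. have := pow2_ge_0 (norm x'). have := pow2_ge_0 (norm y'). lra.
(* Moving from [(x, y)] by [t s] along [(x', y')] changes the squared distance by
   [(t^2 n2 - 2 t) |s|^2], which is negative for this [t] unless [s = 0]. *)
pose t := / (n2 + 1).
have t_pos : 0 < t by apply: Rinv_0_lt_compat; lra.
pose c : C := (RtoC t * s)%C.
have h := hmin _ _ (Gr_plus _ _ _ _ hxy (Gr_scal c _ _ h')).
rewrite /q in h.
have e1 : minus a (plus x (scal c x')) = minus (minus a x) (scal c x') by vec.
have e2 : minus b (plus y (scal c y')) = minus (minus b y) (scal c y') by vec.
rewrite e1 e2 !norm_sub_scal in h.
have hre : Re (Cconj c * inner (minus a x) x')%C + Re (Cconj c * inner (minus b y) y')%C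
    = t * Cmod s ^ 2.
  rewrite -[LHS]/(Re (Cconj c * inner (minus a x) x' + Cconj c * inner (minus b y) y')%C).
  have -> : (Cconj c * inner (minus a x) x' + Cconj c * inner (minus b y) y')%C =
    (Cconj c * s)%C by rewrite /s; ring.
  rewrite /Cmod pow2_sqrt; last nra.
  rewrite /c. case: (s) => s1 s2. rewrite /Re /Cconj /Cmult /RtoC /=. ring.
have hc : Cmod c ^ 2 = t ^ 2 * Cmod s ^ 2.
  rewrite /c Cmod_mult Cmod_R Rabs_pos_eq; [ring|lra].
rewrite !hc in h.
have h3 : 0 <= Cmod s ^ 2 * (t ^ 2 * n2 - 2 * t).
  rewrite /n2. lra.
have ht : t * (n2 + 1) = 1 by rewrite /t; field; lra.
have h4 : t ^ 2 * n2 - 2 * t < 0.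
  have -> : t ^ 2 * n2 = t * (t * (n2 + 1) - t) by ring. rewrite ht. nra.
apply: Cmod_eq_0. have s_pos := Cmod_ge_0 s. apply: Rle_antisym => //.
apply: Rnot_lt_le => hs. have := pow_lt _ 2 hs. nra.
Qed.
End Projection.

Section Adjoints.
Context (X : HilbertSpace).
Add Ring sz_ring_adjoints : (sz_ring X).

Lemma adjoint_unique (T : operator X) v w : densely_defined T ->
  (forall u, dom T u -> inner (T u) v = inner u w) ->
  dom (adjoint T) v /\ adjoint T v = w.
Proof.
move=> hd hw. split; first by exists w.
have uniq : forall w', (forall u, dom T u -> inner (T u) v = inner u w') -> w' = w.
  move=> w' h'. have : minus w' w = zero.
    apply: (orthogonal_to_dense X (dom T)) => // u hu.
    rewrite inner_minus_r -(h' u hu) -(hw u hu). ring.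
  move=> e. have -> : w' = plus (minus w' w) w by vec. rewrite e. vec.
apply: (uniq (adjoint T v)).
apply: (iota_correct (fun w : X => forall u, dom T u -> inner (T u) v = inner u w)).
exists w. split=> [//|w' h']. symmetry. exact: uniq.
Qed.

Lemma adjoint_spec (T : operator X) v u : densely_defined T ->
  dom (adjoint T) v -> dom T u -> inner (T u) v = inner u (adjoint T v).
Proof.
move=> hd [w hw] hu. by rewrite (proj2 (adjoint_unique T v w hd hw)) hw.
Qed.

Lemma adjoint_linear (T : operator X) : densely_defined T -> linear_op (adjoint T).
Proof.
move=> hd.
have hp : forall x y, dom (adjoint T) x -> dom (adjoint T) y ->
    dom (adjoint T) (plus x y) /\ adjoint T (plus x y) = plus (adjoint T x) (adjoint T y).
  move=> x y hx hy. apply: adjoint_unique => // u hu.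
  by rewrite !inner_plus_r !(adjoint_spec T).
have hs : forall a x, dom (adjoint T) x ->
    dom (adjoint T) (scal a x) /\ adjoint T (scal a x) = scal a (adjoint T x).
  move=> a x hx. apply: adjoint_unique => // u hu.
  by rewrite !inner_scal_r (adjoint_spec T).
split; [split; [|split]|split].
- exists zero => u _. by rewrite !inner_zero_r.
- move=> x y hx hy. exact: (proj1 (hp x y hx hy)).
- move=> a x hx. exact: (proj1 (hs a x hx)).
- move=> x y hx hy. exact: (proj2 (hp x y hx hy)).
- move=> a x hx. exact: (proj2 (hs a x hx)).
Qed.

Lemma closed_op_seq (T : operator X) (x y : X) : closed_op T ->
  (forall eps, 0 < eps -> exists x', dom T x' /\
    norm (minus x' x) < eps /\ norm (minus (T x') y) < eps) ->
  dom T x /\ y = T x.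
Proof.
move=> hT h. apply: (hT (x, y)) => [[eps heps]].
case: (h eps (cond_pos eps)) => x' [hx' [h1 h2]].
apply: (heps (x', T x')); last by [].
split => /=; exact: norm_compat1.
Qed.

(** A closed densely defined operator is its own second adjoint. If [(a, b)] is
    the component of [(v, w)] orthogonal to the graph of [T], then [b] lies in
    the domain of the adjoint with image [- a]; testing the hypothesis on [b]
    shows [(a, b)] orthogonal to [(v, w)] too, hence zero. *)
Lemma double_adjoint (T : operator X) (v w : X) :
  linear_op T -> closed_op T -> densely_defined T ->
  (forall u, dom (adjoint T) u -> inner (adjoint T u) v = inner u w) ->
  dom T v /\ T v = w.
Proof.
move=> [[h0 [hp hs]] [hTp hTs]] hcl hd hvw.
case: (projection X (fun x y => dom T x /\ y = T x) _ _ _ _ v w).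
- split=> //. have -> : zero = scal (RtoC 0) zero :> X by vec. rewrite hTs //. vec.
- move=> x y x' y' [hx ->] [hx' ->]. by rewrite hTp //; split=> //; apply: hp.
- move=> c x y [hx ->]. by rewrite hTs //; split=> //; apply: hs.
- move=> x y h. apply: closed_op_seq => // eps he.
  case: (h eps he) => x' [y' [[hx' ->] hh]]. by exists x'.
- move=> x [y [[hx hy] horth]].
  set a := minus v x in horth. set b := minus w y in horth.
  have [hb hb'] : dom (adjoint T) b /\ adjoint T b = opp a.
    apply: adjoint_unique => // u hu. have e := horth u (T u) (conj hu eq_refl).
    rewrite inner_opp_r (inner_conj _ (T u)) (inner_conj _ u a).
    rewrite -Copp_conj. congr Cconj.
    transitivity (inner a u + inner b (T u) + - inner a u)%C; [ring|rewrite e; ring].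
  have h1 := hvw b hb. rewrite hb' inner_opp_l in h1.
  have h2 := horth x y (conj hx hy).
  have h3 : (inner a a + inner b b)%C = RtoC 0.
    rewrite {2}/a {2}/b !inner_minus_r -h1.
    transitivity (- (inner a x + inner b y))%C; [ring|rewrite h2; ring].
  rewrite !inner_norm -RtoC_plus in h3. have h4 := RtoC_inj _ _ h3.
  have := pow2_ge_0 (norm a). have := pow2_ge_0 (norm b) => nb na.
  have ea : a = zero by apply: norm_zero_eq; lra.
  have eb : b = zero by apply: norm_zero_eq; lra.
  have -> : v = x.
    transitivity (plus a x); [rewrite /a; vec|rewrite ea; vec].
  split=> //. rewrite -hy.
  transitivity (plus b y); [rewrite eb; vec|rewrite /b; vec].
Qed.

Lemma kernel_orthogonal (Z : X -> X) (f : X) : is_linear Z -> Z f <> zero ->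
  exists v, v <> zero /\ forall x, Z x = zero -> inner x v = RtoC 0.
Proof.
move=> hZ hf. case: (linear_norm _ hZ) => m [m_pos hm].
case: (projection X (fun x y => Z x = zero /\ y = zero) _ _ _ _ f zero).
- split=> //. exact: linear_zero.
- move=> x y x' y' [hx ->] [hx' ->]. split; last vec.
  rewrite linear_plus // hx hx'. vec.
- move=> c x y [hx ->]. split; last by vec. rewrite linear_scal // hx. vec.
- move=> x y h. split; apply: norm_zero_eq.
  + apply: Rnot_lt_le => hpos.
    have zpos : 0 < norm (Z x) by have := norm_ge_0 (Z x); nra.
    case: (h (norm (Z x) / m)) => [|x' [y' [[hx' _] [hd _]]]].
      exact: Rdiv_lt_0_compat.
    have := hm (minus x' x). rewrite linear_minus // hx'.
    have -> : minus zero (Z x) = opp (Z x) by vec. rewrite norm_opp => hle.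
    have : m * norm (minus x' x) < m * (norm (Z x) / m) by exact: Rmult_lt_compat_l.
    have -> : m * (norm (Z x) / m) = norm (Z x) by field; lra. lra.
  + apply: Rnot_lt_le => hpos.
    have zpos : 0 < norm y by have := norm_ge_0 y; nra.
    case: (h (norm y) zpos) => x' [y' [[_ ->] [_ hd]]].
    move: hd. have -> : minus zero y = opp y by vec. rewrite norm_opp. lra.
- move=> x [y [[hx hy] horth]]. exists (minus f x). split.
  + move=> e. apply: hf. transitivity (plus (Z (minus f x)) (Z x)).
      rewrite -linear_plus //. congr Z. vec.
    rewrite e hx (linear_zero Z) //. vec.
  + move=> u hu. have := horth u zero (conj hu eq_refl).
    rewrite inner_zero_r Cplus_0_r => e.
    rewrite inner_conj e. by rewrite /Cconj /RtoC /= Ropp_0.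
Qed.
End Adjoints.

(** * The Laurent expansion of a resolvent *)

(** [c k] is the coefficient of [(l - mu)^(k - p)] in the expansion of
    [(T - (mu + w)) (T - l)^{-1}], so that [resolvent T (mu + w)] composed with
    [c k] is a Laurent coefficient of the resolvent. Keeping that factor apart
    makes the composition with an operator that is bounded only in the graph
    norm harmless. The relations [lf_first] and [lf_next] compare coefficients
    in [(T - l) (T - l)^{-1} = 1]. *)
Record laurent_family {X : HilbertSpace} (T : operator X) (mu w : C) (l : list X)
  (p : nat) (c : nat -> X -> X) : Prop := {
  lf_shift : w <> RtoC 0;
  lf_resolvent : resolvent_set T (mu + w)%C;
  lf_order : (1 <= p)%nat;
  lf_linear : forall k, is_linear (c k);
  lf_comm : forall k x, resolvent T (mu + w)%C (c k x) = c k (resolvent T (mu + w)%C x);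
  lf_nonzero : exists f, c O f <> zero;
  lf_first : forall x, plus (c O x) (scal w (resolvent T (mu + w)%C (c O x))) = zero;
  lf_next : forall k x,
    minus (plus (c (S k) x) (scal w (resolvent T (mu + w)%C (c (S k) x))))
      (resolvent T (mu + w)%C (c k x)) = if Nat.eqb (S k) p then x else zero;
  lf_rank : forall k x, (k < p)%nat -> span l (c k x);
  lf_growth : exists b rho, Rlt 0 rho /\ forall i x,
    norm (c (p + i)%nat x) <= b * rho ^ i * norm x
}.

Arguments lf_shift {X T mu w l p c} _.
Arguments lf_resolvent {X T mu w l p c} _.
Arguments lf_order {X T mu w l p c} _.
Arguments lf_linear {X T mu w l p c} _.
Arguments lf_comm {X T mu w l p c} _.
Arguments lf_nonzero {X T mu w l p c} _.
Arguments lf_first {X T mu w l p c} _.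
Arguments lf_next {X T mu w l p c} _.
Arguments lf_rank {X T mu w l p c} _.
Arguments lf_growth {X T mu w l p c} _.

Section LaurentFamily.
Context (X : HilbertSpace) (T : operator X) (hT : linear_op T) (mu : C).
Add Ring sz_ring_family : (sz_ring X).

(** An eigenvector of [T] at [mu] is killed by [K = 1 + w R0]; this is what makes
    the order of the pole positive. *)
Lemma laurent_family_exists :
  eigenvalue T mu -> finite_algebraic_multiplicity T mu ->
  exists w l p c, laurent_family T mu w l p c.
Proof.
move=> [u [u0 [hu hTu]]] [r [r_pos [hr [n [e he]]]]].
case: (riesz_complement X T hT mu r r_pos hr) => w [St [w0 [hw [hSt [hcomm hP]]]]].
have hres : resolvent_set T (mu + w)%C.
  apply: hr. have -> : (mu + w - mu = w)%C by ring. split=> //. exact/Cmod_gt_0.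
have hR0 := resolvent_linear X T (mu + w)%C hres.
have hinj : forall x, resolvent T (mu + w)%C x = zero -> x = zero.
  move=> x. exact: resolvent_injective.
pose l := map e (seq 0 (S n)).
have hspan : forall f, span l (riesz_projection T mu r f).
  move=> f. case: (he f I) => cf ->. exact: span_of_sum_n.
case: (laurent_coefficients X (resolvent T (mu + w)%C) St hR0 hSt hcomm hinj w w0 l).
- move=> f. have := hspan f. by rewrite -hP /= !scal_C1.
- exists u. split=> //=. rewrite scal_C1.
  have -> : resolvent T (mu + w)%C u = scal (- / w)%C u.
    rewrite (resolvent_unique X T (mu + w)%C (scal (- / w)%C u) u) //.
    + exact: (proj2 (proj2 (proj1 hT))).
    + rewrite (proj2 (proj2 hT)) // hTu.
      have e1 : (- (mu + w) * - / w = mu * / w + 1)%C by field.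
      transitivity (plus (scal (- / w * mu)%C u) (scal (- (mu + w) * - / w)%C u)); first vec.
      rewrite e1. vec.
  rewrite scal_assoc. have -> : mult w (- / w)%C = (- RtoC 1)%C :> C.
    rewrite /mult /=. by field.
  vec.
- move=> p [c [hp [hc0 [hfirst [hnext [hrank hgrow]]]]]].
  exists w, l, p, (fun k => c k). split=> //.
  + move=> k. exact: op_linear.
  + move=> k x. exact: op_commutes.
  + move=> x. have := f_equal (fun f => op_of X _ _ f x) hfirst => /=.
    by rewrite scal_C1 scal_C0.
  + move=> k x. move: (hnext k).
    by case: (Nat.eqb (S k) p) => /(f_equal (fun f => op_of X _ _ f x)) /=;
      rewrite ?scal_C1 ?scal_C0.
  + move=> k x hk. case: (hrank k hk) => F ->.
    have := hspan (F x). by rewrite -hP /= !scal_C1.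
Qed.

Context (w : C) (l : list X) (p : nat) (c : nat -> X -> X)
  (hc : laurent_family T mu w l p c).

Let R0 := resolvent T (mu + w)%C.
Let R0_lin : is_linear R0 := resolvent_linear X T (mu + w)%C (lf_resolvent hc).

Definition laurent_power (z : C) (k : nat) : C := Cpow_Z z (Z.of_nat k - Z.of_nat p).

Lemma laurent_power_S z k : z <> RtoC 0 ->
  laurent_power z (S k) = (z * laurent_power z k)%C.
Proof.
move=> hz. rewrite /laurent_power.
case: (le_lt_dec p k) => h.
- have -> : (Z.of_nat (S k) - Z.of_nat p)%Z = Z.of_nat (S (k - p)) by lia.
  have -> : (Z.of_nat k - Z.of_nat p)%Z = Z.of_nat (k - p) by lia.
  rewrite [LHS]/= SuccNat2Pos.id_succ.
  case: (k - p)%nat => [|j] //.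
  by rewrite /Z.of_nat /Cpow_Z SuccNat2Pos.id_succ.
- have hneg : forall j, Cpow_Z z (- Z.of_nat j)%Z = (/ (Cpow z j))%C.
    case=> [|j]; first by rewrite /=; field.
    by rewrite /Z.of_nat /Z.opp /Cpow_Z SuccNat2Pos.id_succ.
  have -> : (Z.of_nat (S k) - Z.of_nat p)%Z = (- Z.of_nat (p - S k))%Z by lia.
  have -> : (Z.of_nat k - Z.of_nat p)%Z = (- Z.of_nat (S (p - S k)))%Z by lia.
  rewrite !hneg Cpow_S. field. split=> //. exact: Cpow_nz.
Qed.

Lemma laurent_power_p z : laurent_power z p = RtoC 1.
Proof. by rewrite /laurent_power Z.sub_diag. Qed.

Definition laurent_sum (z : C) (m : nat) (f : X) : X :=
  sum_n (fun k => scal (laurent_power z k) (c k f)) m.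

(** The left-hand side is [(T - l)] applied to [R0 (laurent_sum z m f)], where
    [l = mu + z]. *)
Lemma laurent_sum_telescopes z m f : z <> RtoC 0 ->
  plus (laurent_sum z m f) (scal (w - z)%C (R0 (laurent_sum z m f))) =
  minus (if Nat.leb p m then f else zero)
    (scal (z * laurent_power z m)%C (R0 (c m f))).
Proof.
move=> hz. elim: m => [|m IH].
- have -> : Nat.leb p 0 = false.
    apply/Nat.leb_gt. have := lf_order hc. lia.
  rewrite /laurent_sum sum_O (linear_scal _ R0_lin).
  have h := lf_first hc f. rewrite -/R0 in h.
  transitivity (minus (scal (laurent_power z 0) (plus (c O f) (scal w (R0 (c O f)))))
    (scal (z * laurent_power z 0)%C (R0 (c O f)))); first vec.
  rewrite h. vec.
- rewrite /laurent_sum sum_Sn -/(laurent_sum z m f) (linear_plus _ R0_lin)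
    (linear_scal _ R0_lin).
  have h := lf_next hc m f. rewrite -/R0 in h.
  transitivity (plus (plus (laurent_sum z m f) (scal (w - z)%C (R0 (laurent_sum z m f))))
    (plus (scal (laurent_power z (S m)) (minus (plus (c (S m) f) (scal w (R0 (c (S m) f))))
       (R0 (c m f))))
     (minus (scal (laurent_power z (S m)) (R0 (c m f)))
       (scal (z * laurent_power z (S m))%C (R0 (c (S m) f)))))); first vec.
  rewrite IH h laurent_power_S //.
  case: (Nat.eqb_spec (S m) p) => hm.
  + have -> : Nat.leb p m = false by apply/Nat.leb_gt; lia.
    have -> : Nat.leb p (S m) = true by apply/Nat.leb_le; lia.
    have e : (z * laurent_power z m = 1)%C by rewrite -laurent_power_S // hm laurent_power_p.
    rewrite e. vec.
  + have -> : Nat.leb p (S m) = Nat.leb p m.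
      by case: (Nat.leb_spec p m) => h1; [apply/Nat.leb_le|apply/Nat.leb_gt]; lia.
    case: (Nat.leb p m); vec.
Qed.

Lemma laurent_sum_resolvent z m f : z <> RtoC 0 -> resolvent_set T (mu + z)%C ->
  (p <= m)%nat ->
  R0 (laurent_sum z m f) =
  minus (resolvent T (mu + z)%C f)
    (resolvent T (mu + z)%C (R0 (scal (z * laurent_power z m)%C (c m f)))).
Proof.
move=> hz hres hm.
rewrite -(linear_minus _ _ _ (resolvent_linear X T _ hres)). symmetry.
case: (resolvent_spec X T (mu + w)%C (laurent_sum z m f) (lf_resolvent hc)) => hd he.
apply: resolvent_unique => //.
rewrite -/R0 in he hd *. rewrite he (linear_scal _ R0_lin).
have := laurent_sum_telescopes z m f hz.
have -> : Nat.leb p m = true by apply/Nat.leb_le.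
move=> <-. vec.
Qed.

(** The radius [1 / (2 rho)] turns the growth [rho^i] of the coefficients into
    the decay [2^(- i)]. *)
Lemma laurent_remainder : exists d, 0 < d /\ forall z, 0 < Cmod z < d ->
  exists b, 0 <= b /\ forall i f,
    norm (scal (z * laurent_power z (p + i))%C (c (p + i)%nat f)) <= b * (/ 2) ^ i * norm f.
Proof.
case: (lf_growth hc) => b [rho [hrho hb]].
exists (/ (2 * rho)). split; first by apply: Rinv_0_lt_compat; lra.
move=> z [hz hd].
have hz0 : z <> RtoC 0 by apply/Cmod_gt_0.
exists (Cmod z * Rabs b). split.
  apply: Rmult_le_pos; [lra|exact: Rabs_pos].
move=> i f. apply: Rle_trans (norm_scal _ _) _.
change (Cmod (z * laurent_power z (p + i)) * norm (c (p + i)%nat f) <=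
  Cmod z * Rabs b * (/ 2) ^ i * norm f).
have hpow : Cmod (laurent_power z (p + i)) = Cmod z ^ i.
  elim: i => [|i IH].
  - by rewrite Nat.add_0_r laurent_power_p Cmod_R Rabs_R1.
  - by rewrite -plus_n_Sm laurent_power_S // Cmod_mult IH.
rewrite Cmod_mult hpow.
have h1 : norm (c (p + i)%nat f) <= Rabs b * rho ^ i * norm f.
  apply: Rle_trans (hb i f) _. apply: Rmult_le_compat_r; first exact: norm_ge_0.
  apply: Rmult_le_compat_r; [apply: pow_le; lra|exact: Rle_abs].
have h2 : Cmod z ^ i * rho ^ i <= (/ 2) ^ i.
  rewrite -Rpow_mult_distr. apply: pow_incr. split.
    apply: Rmult_le_pos; lra.
  have -> : / 2 = / (2 * rho) * rho by field; lra.
  apply: Rmult_le_compat_r; lra.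
apply: Rle_trans (_ : _ <= Cmod z * Cmod z ^ i * (Rabs b * rho ^ i * norm f)) _.
  apply: Rmult_le_compat_l => //. apply: Rmult_le_pos; [lra|apply: pow_le; lra].
have -> : Cmod z * Cmod z ^ i * (Rabs b * rho ^ i * norm f) =
  (Cmod z ^ i * rho ^ i) * (Cmod z * Rabs b * norm f) by ring.
have -> : Cmod z * Rabs b * (/ 2) ^ i * norm f =
  (/ 2) ^ i * (Cmod z * Rabs b * norm f) by ring.
apply: Rmult_le_compat_r => //. apply: Rmult_le_pos; last exact: norm_ge_0.
apply: Rmult_le_pos; [lra|exact: Rabs_pos].
Qed.

Lemma geometric_small b eps : 0 <= b -> 0 < eps ->
  exists N, forall i, (N <= i)%nat -> b * (/ 2) ^ i <= eps.
Proof.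
move=> hb he.
have habs : Rabs (/ 2) < 1 by rewrite Rabs_pos_eq; lra.
have he' : 0 < eps / (b + 1) by apply: Rdiv_lt_0_compat; lra.
case: (pow_lt_1_zero _ habs _ he') => N hN. exists N => i hi.
have := hN i hi. have hp : 0 <= (/ 2) ^ i by apply: pow_le; lra.
rewrite Rabs_pos_eq // => h.
have -> : eps = (b + 1) * (eps / (b + 1)) by field; lra.
nra.
Qed.

Lemma laurent_remainder_image (Y : HilbertSpace) (L : X -> Y) z b : is_linear L ->
  0 <= b -> (forall i f,
    norm (scal (z * laurent_power z (p + i))%C (c (p + i)%nat f)) <= b * (/ 2) ^ i * norm f) ->
  forall eps, 0 < eps -> exists N, forall m, (N <= m)%nat -> (p <= m)%nat /\ forall f,
    norm (L (scal (z * laurent_power z m)%C (c m f))) <= eps * norm f.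
Proof.
move=> hL hb h eps he. case: (linear_norm _ hL) => M [M_pos hM].
case: (geometric_small (M * b) eps) => //; first by apply: Rmult_le_pos; lra.
move=> N hN. exists (p + N)%nat => m hm. split; first lia.
move=> f. apply: Rle_trans (hM _) _.
have -> : m = (p + (m - p))%nat by lia.
apply: Rle_trans (_ : _ <= M * (b * (/ 2) ^ (m - p) * norm f)) _.
  apply: Rmult_le_compat_l; [lra|exact: h].
have -> : M * (b * (/ 2) ^ (m - p) * norm f) = M * b * (/ 2) ^ (m - p) * norm f by ring.
apply: Rmult_le_compat_r; first exact: norm_ge_0. apply: hN. lia.
Qed.

Lemma laurent_family_pole : (exists r, 0 < r /\ forall z, 0 < Cmod z < r ->
    resolvent_set T (mu + z)%C) -> resolvent_pole T mu p.
Proof.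
move=> [r [r_pos hr]].
exists (fun n x => R0 (c (Z.to_nat (n + Z.of_nat p)) x)).
split; first exact: (lf_order hc).
split.
  move=> n _. apply: (is_linear_comp (c _) R0); last exact: R0_lin.
  exact: (lf_linear hc).
split.
  case: (lf_nonzero hc) => f hf. exists f.
  have -> : Z.to_nat (- Z.of_nat p + Z.of_nat p) = O by lia.
  move=> h0. apply: hf. exact: (resolvent_injective X T hT _ _ (lf_resolvent hc) h0).
case: laurent_remainder => d [hd hrem].
exists (Rmin r d). split; first exact: Rmin_glb_lt.
move=> lam [h1 h2].
have [z ez] : exists z, lam = (mu + z)%C by exists (lam - mu)%C; ring.
subst lam. have ez : (mu + z - mu = z)%C by ring.
rewrite ez in h1 h2 *.
have hz : z <> RtoC 0 by apply/Cmod_gt_0.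
have hres : resolvent_set T (mu + z)%C.
  apply: hr. split=> //. exact: Rlt_le_trans h2 (Rmin_l _ _).
split=> // eps heps.
have hrem' := hrem z (conj h1 (Rlt_le_trans _ _ _ h2 (Rmin_r _ _))).
case: hrem' => b [hb hrem'].
have hL : is_linear (fun x => resolvent T (mu + z)%C (R0 x)).
  exact: (is_linear_comp R0 _ R0_lin (resolvent_linear X T _ hres)).
case: (laurent_remainder_image X _ z b hL hb hrem' eps heps) => N hN.
exists N => m hm f. case: (hN m hm) => hpm hbound.
have -> : sum_n (laurent_term (fun n x => R0 (c (Z.to_nat (n + Z.of_nat p)) x)) p z f) m =
    R0 (laurent_sum z m f).
  rewrite /laurent_sum. elim: (m) => [|k IH].
  - rewrite !sum_O (linear_scal _ R0_lin) /laurent_term.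
    rewrite /laurent_power. by have -> : Z.to_nat (Z.of_nat 0 - Z.of_nat p + Z.of_nat p) = O by lia.
  - rewrite !sum_Sn (linear_plus _ R0_lin (sum_n _ k)) -IH (linear_scal _ R0_lin) /laurent_term.
    rewrite /laurent_power. by have -> : Z.to_nat (Z.of_nat (S k) - Z.of_nat p + Z.of_nat p) = S k by lia.
rewrite laurent_sum_resolvent //.
have -> : forall x y : X, minus (minus x y) x = opp y by move=> x y; vec.
rewrite norm_opp. exact: hbound.
Qed.
End LaurentFamily.

(** * The M-function *)

Section MFunction.
Context (H HH KK : HilbertSpace) (A At : operator H)
  (hAt_lin : linear_op At) (hAt_closed : closed_op At)
  (hAt_dense : densely_defined At) (hpair : adjoint_pair A At)
  (G1 : H -> HH) (G2 : H -> KK) (Gt1 : H -> KK) (Gt2 : H -> HH)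
  (htriplet : boundary_triplet A At G1 G2 Gt1 Gt2)
  (B : KK -> HH) (hB : is_linear B).
Add Ring sz_ring_H : (sz_ring H).
Add Ring sz_ring_HH : (sz_ring HH).
Add Ring sz_ring_KK : (sz_ring KK).

Let adj := adjoint At.
Let T := A_B At G1 G2 B.
Let bdry := bdry_map G1 G2 B.

Lemma adj_sub : is_subspace (dom adj).
Proof. exact: (proj1 (adjoint_linear H At hAt_dense)). Qed.

Lemma adj_plus u v : dom adj u -> dom adj v -> adj (plus u v) = plus (adj u) (adj v).
Proof. exact: (proj1 (proj2 (adjoint_linear H At hAt_dense))). Qed.

Lemma adj_scal a u : dom adj u -> adj (scal a u) = scal a (adj u).
Proof. exact: (proj2 (proj2 (adjoint_linear H At hAt_dense))). Qed.

Lemma dom_plus u v : dom adj u -> dom adj v -> dom adj (plus u v).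
Proof. exact: (proj1 (proj2 adj_sub)). Qed.

Lemma dom_scal a u : dom adj u -> dom adj (scal a u).
Proof. exact: (proj2 (proj2 adj_sub)). Qed.

Lemma G2_linear : linear_on (dom adj) G2.
Proof. exact: (proj1 (bt_G2 _ _ _ _ _ _ htriplet)). Qed.

Lemma G2_plus u v : dom adj u -> dom adj v -> G2 (plus u v) = plus (G2 u) (G2 v).
Proof. exact: (proj1 (proj2 G2_linear)). Qed.

Lemma G2_scal a u : dom adj u -> G2 (scal a u) = scal a (G2 u).
Proof. exact: (proj2 (proj2 G2_linear)). Qed.

Lemma bdry_plus u v : dom adj u -> dom adj v ->
  bdry (plus u v) = plus (bdry u) (bdry v).
Proof.
move=> hu hv. rewrite /bdry /bdry_map G2_plus //.
rewrite (proj1 (proj2 (proj1 (bt_G1 _ _ _ _ _ _ htriplet)))) // linear_plus //. vec.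
Qed.

Lemma bdry_scal a u : dom adj u -> bdry (scal a u) = scal a (bdry u).
Proof.
move=> hu. rewrite /bdry /bdry_map G2_scal //.
rewrite (proj2 (proj2 (proj1 (bt_G1 _ _ _ _ _ _ htriplet)))) // linear_scal //. vec.
Qed.

Lemma A_B_linear : linear_op T.
Proof.
have z0 : zero = scal (RtoC 0) zero :> H by vec.
split; [split; [|split]|split].
- split; first exact: (proj1 adj_sub).
  have h : bdry (scal (RtoC 0) zero) = zero.
    rewrite bdry_scal; [vec|exact: (proj1 adj_sub)].
  by rewrite -z0 in h.
- move=> x y [dx bx] [dy b_y]. split; first exact: dom_plus.
  change (bdry (plus x y) = zero). rewrite bdry_plus //.
  rewrite /bdry bx b_y. vec.
- move=> a x [dx bx]. split; first exact: dom_scal.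
  change (bdry (scal a x) = zero). rewrite bdry_scal // /bdry bx. vec.
- move=> x y [dx _] [dy _]. exact: adj_plus.
- move=> a x [dx _]. exact: adj_scal.
Qed.

(** The graph norm of [R(l) f] is controlled by the norm of [f], since
    [At^* R(l) f = f + l R(l) f]. *)
Lemma G2_resolvent_linear l : resolvent_set T l ->
  is_linear (fun f => G2 (resolvent T l f)).
Proof.
move=> h. have hR := resolvent_linear H T l h.
have hd : forall f, dom adj (resolvent T l f).
  move=> f. exact: (proj1 (proj1 (resolvent_spec H T l f h))).
split.
- move=> f g. by rewrite (linear_plus _ hR) G2_plus.
- move=> a f. by rewrite (linear_scal _ hR) G2_scal.
- case: (proj1 (proj2 (bt_G2 _ _ _ _ _ _ htriplet))) => M hM.
  case: (linear_norm _ hR) => m [m_pos hm].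
  have cl := Cmod_ge_0 l.
  exists ((Rabs M + 1) * (m + (1 + Cmod l * m))).
  have aM := Rabs_pos M.
  split; first by apply: Rmult_lt_0_compat; nra.
  move=> f. set v := resolvent T l f.
  have hTv : adj v = plus f (scal l v) by exact: (proj2 (resolvent_spec H T l f h)).
  apply: Rle_trans (hM v (hd f)) _.
  have hg : graph_norm (adjoint At) v <= norm v + norm (adj v).
    rewrite /graph_norm -/adj.
    have n1 := norm_ge_0 v. have n2 := norm_ge_0 (adj v).
    rewrite -[X in _ <= X]sqrt_pow2; last lra.
    apply: sqrt_le_1_alt. nra.
  have h1 : norm v <= m * norm f by exact: hm.
  have h2 : norm (adj v) <= norm f + Cmod l * norm v.
    rewrite hTv. apply: Rle_trans (norm_triangle _ _) _.
    apply: Rplus_le_compat_l. exact: norm_scal.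
  have g0 : 0 <= graph_norm (adjoint At) v by exact: sqrt_pos.
  have nf := norm_ge_0 f. have nv := norm_ge_0 v.
  apply: Rle_trans (_ : _ <= (Rabs M + 1) * graph_norm (adjoint At) v) _.
    apply: Rmult_le_compat_r => //. have := Rle_abs M. lra.
  rewrite Rmult_assoc. apply: Rmult_le_compat_l; first lra.
  have h3 : Cmod l * norm v <= Cmod l * (m * norm f) by exact: Rmult_le_compat_l.
  lra.
Qed.

(** Von Neumann type splitting of the domain: subtracting an element of [dom T]
    leaves the boundary value unchanged. *)
Lemma kernel_part l u : resolvent_set T l -> dom adj u ->
  in_ker_shift adj l (minus u (resolvent T l (minus (adj u) (scal l u)))) /\
  bdry (minus u (resolvent T l (minus (adj u) (scal l u)))) = bdry u.
Proof.
move=> h hu. set g := minus (adj u) (scal l u).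
case: (resolvent_spec H T l g h) => [[hd hb] he].
have e1 : minus u (resolvent T l g) = plus u (scal (- (1))%C (resolvent T l g)) by vec.
have hd' := dom_scal (- (1))%C _ hd.
rewrite e1. split.
- split; first exact: dom_plus.
  rewrite adj_plus // adj_scal //.
  change (adj (resolvent T l g)) with (T (resolvent T l g)). rewrite he /g. vec.
- rewrite bdry_plus // bdry_scal // /bdry hb. vec.
Qed.

Lemma kernel_unique l u v : resolvent_set T l ->
  in_ker_shift adj l u -> in_ker_shift adj l v -> bdry u = bdry v -> u = v.
Proof.
move=> h [du eu] [dv ev] hb.
have dv' := dom_scal (- (1))%C _ dv.
have hd : dom T (plus u (scal (- (1))%C v)).
  split; first exact: dom_plus.
  change (bdry (plus u (scal (- (1))%C v)) = zero).
  rewrite bdry_plus // bdry_scal // hb. vec.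
have e : resolvent T l zero = plus u (scal (- (1))%C v).
  apply: resolvent_unique => //.
  change (T (plus u (scal (- (1))%C v))) with (adj (plus u (scal (- (1))%C v))).
  rewrite adj_plus // adj_scal // eu ev. vec.
rewrite (linear_zero _ (resolvent_linear H T l h)) in e.
transitivity (plus v (plus u (scal (- (1))%C v))); [vec|rewrite -e; vec].
Qed.

Lemma M_function_value l u : resolvent_set T l -> in_ker_shift adj l u ->
  M_function At G1 G2 B l (bdry u) = G2 u.
Proof.
move=> h hu.
have uniq : forall g, (exists v, in_ker_shift adj l v /\ bdry v = bdry u /\ G2 v = g) ->
    g = G2 u.
  move=> g [v [hv [hb <-]]]. by rewrite (kernel_unique l v u h hv hu hb).
apply: (uniq (M_function At G1 G2 B l (bdry u))).
apply: (iota_correct (fun g : KK => exists v : H,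
  in_ker_shift (adjoint At) l v /\ bdry_map G1 G2 B v = bdry u /\ G2 v = g)).
exists (G2 u). split; first by exists u.
move=> g hg. symmetry. exact: uniq.
Qed.

(** A kernel element [u] at [l0] becomes the kernel element
    [u + (l - l0) R(l) u] at [l], with the same boundary value. *)
Lemma M_function_transport l0 l u : resolvent_set T l -> in_ker_shift adj l0 u ->
  M_function At G1 G2 B l (bdry u) = plus (G2 u) (scal (l - l0)%C (G2 (resolvent T l u))).
Proof.
move=> h [du eu]. case: (kernel_part l u h du) => hk hb.
rewrite -hb (M_function_value l _ h hk).
have e : minus (adj u) (scal l u) = scal (- (l - l0))%C u by rewrite eu; vec.
have hdr := proj1 (proj1 (resolvent_spec H T l u h)).
rewrite e (linear_scal _ (resolvent_linear H T l h)).
have e2 : minus u (scal (- (l - l0))%C (resolvent T l u)) =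
  plus u (scal (l - l0)%C (resolvent T l u)) by vec.
rewrite e2 G2_plus //; last exact: dom_scal. by rewrite G2_scal.
Qed.

(** Fixing the solution operator at one point of the resolvent set makes every
    Laurent coefficient of the M-function a function of the boundary value,
    linear because the solution is unique. *)
Lemma poisson_operator l : resolvent_set T l -> exists U : HH -> H,
  forall f, bdry_range At G1 G2 B f -> in_ker_shift adj l (U f) /\ bdry (U f) = f.
Proof.
move=> h.
have hex : forall f, exists u, bdry_range At G1 G2 B f ->
    in_ker_shift adj l u /\ bdry u = f.
  move=> f. case: (classic (bdry_range At G1 G2 B f)) => hf.
  - case: (hf) => u [du bu]. case: (kernel_part l u h du) => h1 h2.
    eexists => _. split; [exact: h1|]. by rewrite h2.
  - by exists zero.
case: (choice _ hex) => U hU. by exists U.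
Qed.

Lemma bdry_range_subspace : is_subspace (bdry_range At G1 G2 B).
Proof.
have z0 : zero = scal (RtoC 0) zero :> H by vec.
split; [|split].
- exists zero. split; first exact: (proj1 adj_sub).
  change (bdry zero = zero). rewrite z0 bdry_scal; [vec|exact: (proj1 adj_sub)].
- move=> f g [u [du <-]] [v [dv <-]]. exists (plus u v).
  split; [exact: dom_plus|exact: bdry_plus].
- move=> a f [u [du <-]]. exists (scal a u). split; [exact: dom_scal|exact: bdry_scal].
Qed.

Lemma poisson_linear l (U : HH -> H) : resolvent_set T l ->
  (forall f, bdry_range At G1 G2 B f -> in_ker_shift adj l (U f) /\ bdry (U f) = f) ->
  linear_on (bdry_range At G1 G2 B) U.
Proof.
move=> h hU. have [_ [rp rs]] := bdry_range_subspace.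
split; first exact: bdry_range_subspace. split.
- move=> f g hf hg. case: (hU f hf) => [[df ef] bf]. case: (hU g hg) => [[dg eg] bg].
  case: (hU _ (rp _ _ hf hg)) => hk hb.
  apply: (kernel_unique l) => //.
  + split; first exact: dom_plus. rewrite adj_plus // ef eg. vec.
  + by rewrite hb bdry_plus // bf bg.
- move=> a f hf. case: (hU f hf) => [[df ef] bf].
  case: (hU _ (rs a _ hf)) => hk hb.
  apply: (kernel_unique l) => //.
  + split; first exact: dom_scal. rewrite adj_scal // ef. vec.
  + by rewrite hb bdry_scal // bf.
Qed.

Context (mu w : C) (l : list H) (p : nat) (c : nat -> H -> H)
  (hc : laurent_family T mu w l p c).
Let R0 := resolvent T (mu + w)%C.
Let hres0 : resolvent_set T (mu + w)%C := lf_resolvent hc.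
Let R0_lin : is_linear R0 := resolvent_linear H T (mu + w)%C hres0.
Let Gam (x : H) : KK := G2 (R0 x).
Let Gam_lin : is_linear Gam := G2_resolvent_linear (mu + w)%C hres0.

(** This is where both unique continuation hypotheses enter: the first passes
    from [G2 Z = 0] to [Z = 0] on the kernel at [mu + w], where [Z = R0 c_0] is
    the leading coefficient of the resolvent, and the second rules out a
    vector orthogonal to [ker Z]. *)
Lemma leading_coefficient_visible
  (huc : unique_continuation adj mu G1 G2)
  (huct : unique_continuation (adjoint A) (Cconj mu) Gt1 Gt2) :
  exists u, in_ker_shift adj (mu + w)%C u /\ Gam (c O u) <> zero.
Proof.
apply: NNPP => hn.
pose Z x := R0 (c O x).
have hZ_lin : is_linear Z.
  apply: (is_linear_comp (c O) R0) => //. exact: (lf_linear hc).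
have hc0 : forall x, c O x = scal (- w)%C (Z x).
  move=> x. have h := lf_first hc x. rewrite -/R0 -/(Z x) in h.
  transitivity (minus (plus (c O x) (scal w (Z x))) (scal w (Z x))); first vec.
  rewrite h. vec.
have hZ_ker : forall x, in_ker_shift adj mu (Z x) /\ bdry (Z x) = zero.
  move=> x. case: (resolvent_spec H T (mu + w)%C (c O x) hres0) => [[hd hb] he].
  split=> //. split=> //. transitivity (T (Z x)) => //. rewrite /Z /R0 he -/R0 -/(Z x) hc0. vec.
have hZ0 : forall u, in_ker_shift adj (mu + w)%C u -> Z u = zero.
  move=> u hu. have hG2 : G2 (Z u) = zero.
    apply: NNPP => h. apply: hn. by exists u.
  case: (hZ_ker u) => hk hb. apply: huc => //.
  move: hb. rewrite /bdry /bdry_map hG2 (linear_zero B) // => <-. vec.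
(* [u] differs from a kernel element by [R0 g], so [Z u = Z (R0 g)] and the claim
   becomes [R0] of the relation [c 0 g + w R0 (c 0 g) = 0]. *)
have hZ_ran : forall u, dom adj u -> Z (minus (adj u) (scal mu u)) = zero.
  move=> u hu. case: (kernel_part (mu + w)%C u hres0 hu) => hk _.
  set g := minus (adj u) (scal (mu + w)%C u) in hk. 
  have h1 := hZ0 _ hk. rewrite (linear_minus _ _ _ hZ_lin) -/(R0 g) in h1.
  have h2 : Z (R0 g) = R0 (Z g).
    rewrite /Z. congr R0. symmetry. exact: (lf_comm hc).
  have -> : minus (adj u) (scal mu u) = plus g (scal w u) by rewrite /g; vec.
  rewrite (linear_plus _ hZ_lin) (linear_scal _ hZ_lin).
  have -> : Z u = R0 (Z g).
    transitivity (plus (minus (Z u) (Z (R0 g))) (Z (R0 g))); first vec.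
    rewrite h1 h2. vec.
  rewrite /Z -(linear_scal _ R0_lin) -(linear_plus _ R0_lin).
  rewrite (lf_first hc g). exact: linear_zero.
case: (lf_nonzero hc) => f hf.
have hZf : Z f <> zero.
  move=> h. apply: hf. rewrite hc0 h. vec.
case: (kernel_orthogonal H Z f hZ_lin hZf) => v [hv horth].
have [dv ev] : dom At v /\ At v = scal (Cconj mu) v.
  apply: double_adjoint => // u hu.
  have := horth _ (hZ_ran u hu).
  rewrite inner_minus_l inner_scal_l inner_scal_r Cconj_conj => e.
  transitivity (inner (adjoint At u) v - mu * inner u v + mu * inner u v)%C; first ring.
  rewrite -/adj e. ring.
case: (proj1 hpair v dv) => dv' ev'.
case: (proj1 (bt_dom_At _ _ _ _ _ _ htriplet v) dv) => _ [h1 h2].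
apply: hv. apply: huct => //. split=> //. by rewrite ev'.
Qed.

Context (U : HH -> H)
  (hU : forall f, bdry_range At G1 G2 B f ->
     in_ker_shift adj (mu + w)%C (U f) /\ bdry (U f) = f).

(** The coefficient of [(l - mu)^(k - p)] in
    [G2 (U f) + ((l - mu) - w) G2 (R(l) (U f))]: multiplication by [l - mu]
    shifts the coefficients of the resolvent by one. *)
Definition M_coefficient (k : nat) (f : HH) : KK :=
  minus
    (plus (if Nat.eqb k p then G2 (U f) else zero)
      (match k with O => zero | S j => Gam (c j (U f)) end))
    (scal w (Gam (c k (U f)))).

Lemma M_coefficient_linear k : linear_on (bdry_range At G1 G2 B) (M_coefficient k).
Proof.
have [hs [Up Us]] := poisson_linear (mu + w)%C U hres0 hU.
have cl := lf_linear hc.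
split=> //. split.
- move=> f g hf hg. rewrite /M_coefficient Up //.
  rewrite (linear_plus _ (cl k)) (linear_plus _ Gam_lin).
  rewrite G2_plus; [|exact: (proj1 (proj1 (hU f hf)))|exact: (proj1 (proj1 (hU g hg)))].
  case: (k) => [|j]; last rewrite (linear_plus _ (cl j)) (linear_plus _ Gam_lin);
    case: (Nat.eqb _ _); vec.
- move=> a f hf. rewrite /M_coefficient Us //.
  rewrite (linear_scal _ (cl k)) (linear_scal _ Gam_lin).
  rewrite G2_scal; last exact: (proj1 (proj1 (hU f hf))).
  case: (k) => [|j]; last rewrite (linear_scal _ (cl j)) (linear_scal _ Gam_lin);
    case: (Nat.eqb _ _); vec.
Qed.

Lemma M_coefficient_finite_rank k : (k < p)%nat ->
  finite_rank (bdry_range At G1 G2 B) (M_coefficient k).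
Proof.
move=> hk.
exists (length (map Gam l)), (fun i => nth i (map Gam l) zero) => f _.
apply: sum_n_of_span.
have hs : forall j, (j < p)%nat -> span (map Gam l) (Gam (c j (U f))).
  move=> j hj. apply: span_linear_image => //. exact: (lf_rank hc).
have hsub := span_subspace KK (map Gam l).
rewrite /M_coefficient. have -> : Nat.eqb k p = false by apply/Nat.eqb_neq; lia.
apply: subspace_minus => //.
- apply: (proj1 (proj2 hsub)); first exact: (proj1 hsub).
  case: k hk => [|j] hj; [exact: (proj1 hsub)|apply: hs; lia].
- apply: (proj2 (proj2 hsub)). exact: hs.
Qed.

Lemma M_partial_sum z f m : z <> RtoC 0 ->
  sum_n (fun k => scal (laurent_power p z k) (M_coefficient k f)) m =
  minus (plus (if Nat.leb p m then G2 (U f) else zero)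
    (scal (z - w)%C (Gam (laurent_sum H p c z m (U f)))))
    (Gam (scal (z * laurent_power p z m)%C (c m (U f)))).
Proof.
move=> hz. rewrite (linear_scal _ Gam_lin). elim: m => [|m IH].
- rewrite sum_O /laurent_sum sum_O (linear_scal _ Gam_lin) /M_coefficient.
  have h1 := lf_order hc.
  have -> : Nat.leb p 0 = false by apply/Nat.leb_gt; lia.
  have -> : Nat.eqb 0 p = false by apply/Nat.eqb_neq; lia.
  vec.
- rewrite sum_Sn IH /laurent_sum sum_Sn -/(laurent_sum H p c z m (U f)).
  rewrite (linear_plus _ Gam_lin (laurent_sum H p c z m (U f))) (linear_scal _ Gam_lin)
    /M_coefficient.
  rewrite laurent_power_S //.
  case: (Nat.eqb_spec (S m) p) => hm.
  + have -> : Nat.leb p m = false by apply/Nat.leb_gt; lia.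
    have -> : Nat.leb p (S m) = true by apply/Nat.leb_le; lia.
    have e : (z * laurent_power p z m = 1)%C.
      by rewrite -laurent_power_S // hm laurent_power_p.
    rewrite e. vec.
  + have -> : Nat.leb p (S m) = Nat.leb p m.
      by case: (Nat.leb_spec p m) => h1; [apply/Nat.leb_le|apply/Nat.leb_gt]; lia.
    case: (Nat.leb p m); vec.
Qed.

(** The error after [m] terms is a bounded operator [L] applied to the remainder
    of the expansion of the resolvent. *)
Lemma M_series : (exists r, 0 < r /\ forall z, 0 < Cmod z < r ->
    resolvent_set T (mu + z)%C) ->
  exists r, 0 < r /\ forall z, 0 < Cmod z < r -> resolvent_set T (mu + z)%C /\
    forall f, bdry_range At G1 G2 B f ->
      is_series (fun k => scal (laurent_power p z k) (M_coefficient k f))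
        (M_function At G1 G2 B (mu + z)%C f).
Proof.
move=> [r [r_pos hr]].
case: (laurent_remainder H T mu w l p c hc) => d [hd hrem].
exists (Rmin r d). split; first exact: Rmin_glb_lt.
move=> z [h1 h2].
have hz : z <> RtoC 0 by apply/Cmod_gt_0.
have hres : resolvent_set T (mu + z)%C.
  apply: hr. split=> //. exact: Rlt_le_trans h2 (Rmin_l _ _).
split=> // f hf.
case: (hrem z (conj h1 (Rlt_le_trans _ _ _ h2 (Rmin_r _ _)))) => b [hb hrem'].
case: (hU f hf) => hk hbf. set u := U f.
have hdT : forall l' x, resolvent_set T l' -> dom adj (resolvent T l' x).
  move=> l' x hl'. exact: (proj1 (proj1 (resolvent_spec H T l' x hl'))).
have hGz := G2_resolvent_linear (mu + z)%C hres.
pose L x := plus (scal (z - w)%C (G2 (resolvent T (mu + z)%C (R0 x)))) (Gam x).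
have hGR : is_linear (fun x => G2 (resolvent T (mu + z)%C (R0 x))).
  exact: (is_linear_comp R0 _ R0_lin hGz).
have hL : is_linear L.
  have hpr := is_linear_prod _ _
    (is_linear_comp _ (fun y : KK => scal (z - w)%C y) hGR (is_linear_scal_C KK (z - w)%C)) Gam_lin.
  exact: (is_linear_comp _ (fun t : KK * KK => plus (fst t) (snd t)) hpr is_linear_plus).
have herr : forall m, (p <= m)%nat ->
    minus (sum_n (fun k => scal (laurent_power p z k) (M_coefficient k f)) m)
      (M_function At G1 G2 B (mu + z)%C f) =
    opp (L (scal (z * laurent_power p z m)%C (c m u))).
  move=> m hm. rewrite M_partial_sum //.
  have -> : Nat.leb p m = true by apply/Nat.leb_le.
  have hM := M_function_transport (mu + w)%C (mu + z)%C _ hres hk.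
  rewrite hbf in hM. rewrite hM.
  have e1 : (mu + z - (mu + w) = z - w)%C by ring.
  rewrite e1 -/u /L.
  have e2 : Gam (laurent_sum H p c z m u) = minus (G2 (resolvent T (mu + z)%C u))
      (G2 (resolvent T (mu + z)%C (R0 (scal (z * laurent_power p z m)%C (c m u))))).
    have hls := laurent_sum_resolvent H T mu w l p c hc z m u hz hres hm.
    rewrite /Gam /R0 hls -(linear_minus _ _ _ (resolvent_linear H T _ hres)).
    by rewrite (linear_minus _ _ _ hGz).
  rewrite e2. vec.
apply/(@filterlim_locally _ KK) => eps.
have nu := norm_ge_0 u.
have heps : 0 < eps / (norm u + 1) by apply: Rdiv_lt_0_compat; [exact: cond_pos|lra].
case: (laurent_remainder_image H p c KK L z b hL hb hrem' _ heps) => N hN.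
exists N => m hm. case: (hN m hm) => hpm hbound.
apply: norm_compat1. rewrite (herr m hpm) norm_opp.
apply: Rle_lt_trans (hbound u) _.
have e : pos eps = eps / (norm u + 1) * (norm u + 1) by field; lra.
rewrite {2}e. apply: Rmult_lt_compat_l => //. lra.
Qed.
End MFunction.

Theorem theorem4p4 (H HH KK : HilbertSpace) (A At : operator H)
  (hA_lin : linear_op A) (hA_closed : closed_op A) (hA_dense : densely_defined A)
  (hAt_lin : linear_op At) (hAt_closed : closed_op At)
  (hAt_dense : densely_defined At)
  (hpair : adjoint_pair A At)
  (G1 : H -> HH) (G2 : H -> KK) (Gt1 : H -> KK) (Gt2 : H -> HH)
  (htriplet : boundary_triplet A At G1 G2 Gt1 Gt2)
  (B : KK -> HH) (hB : is_linear B)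
  (hrho : exists l : C, resolvent_set (A_B At G1 G2 B) l)
  (mu : C)
  (heig : eigenvalue (A_B At G1 G2 B) mu)
  (hiso : isolated_spectral_point (A_B At G1 G2 B) mu)
  (hfin : finite_algebraic_multiplicity (A_B At G1 G2 B) mu)
  (huc : unique_continuation (adjoint At) mu G1 G2)
  (huct : unique_continuation (adjoint A) (Cconj mu) Gt1 Gt2) :
  exists p : nat,
    M_pole_finite_multiplicity At G1 G2 B mu p /\
    resolvent_pole (A_B At G1 G2 B) mu p.
Proof.
have hT := A_B_linear H HH KK A At hAt_dense G1 G2 Gt1 Gt2 htriplet B hB.
case: (laurent_family_exists H _ hT mu heig hfin) => w [l [p [c hc]]].
have hpunct : exists r, 0 < r /\ forall z, 0 < Cmod z < r ->
    resolvent_set (A_B At G1 G2 B) (mu + z)%C.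
  case: hiso => _ [r [r_pos hr]]. exists r. split=> // z hz. apply: hr.
  by have -> : (mu + z - mu = z)%C by ring.
exists p. split; last exact: (laurent_family_pole H _ hT mu w l p c hc hpunct).
have hres0 := lf_resolvent hc.
case: (poisson_operator H HH KK A At hAt_dense G1 G2 Gt1 Gt2 htriplet B hB _ hres0) => U hU.
exists (fun n => M_coefficient H HH KK At G1 G2 B mu w p c U (Z.to_nat (n + Z.of_nat p))).
split; last first.
  move=> n hn. eapply M_coefficient_finite_rank; [eassumption|exact: hc|lia].
split; first exact: (lf_order hc).
split.
  move=> n hn. eapply M_coefficient_linear; eassumption.
split.
- case: (leading_coefficient_visible H HH KK A At hAt_lin hAt_closed hAt_dense hpair
    G1 G2 Gt1 Gt2 htriplet B hB mu w l p c hc huc huct) => u [hu hGu].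
  have hf : bdry_range At G1 G2 B (bdry_map G1 G2 B u) by exists u; split=> //; exact: (proj1 hu).
  exists (bdry_map G1 G2 B u). split=> //.
  have -> : Z.to_nat (- Z.of_nat p + Z.of_nat p) = O by lia.
  case: (hU _ hf) => hk hb.
  have eU : U (bdry_map G1 G2 B u) = u.
    exact: (kernel_unique H HH KK A At hAt_dense G1 G2 Gt1 Gt2 htriplet B hB _ _ _ hres0 hk hu hb).
  rewrite /M_coefficient eU.
  have -> : Nat.eqb 0 p = false.
    apply/Nat.eqb_neq. have := lf_order hc. lia.
  move=> h0. apply: hGu.
  have w0 := lf_shift hc.
  set g := G2 _ in h0 *.
  have -> : g = scal (/ w * w)%C g by rewrite Cinv_l // scal_C1.
  rewrite -scal_assoc. have -> : scal w g = zero.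
    transitivity (opp (minus (plus zero zero) (scal w g))).
      rewrite plus_zero_l /minus plus_zero_l. by rewrite opp_opp.
    by rewrite h0 opp_zero.
  exact: scal_zero_r.
- case: (M_series H HH KK A At hAt_dense G1 G2 Gt1 Gt2 htriplet B hB mu w l p c hc U hU hpunct)
    => r [r_pos hr].
  exists r. split=> // lam hlam.
  case: (hr (lam - mu)%C hlam) => hres hser.
  have elam : (mu + (lam - mu) = lam)%C by ring.
  rewrite elam in hres hser. split=> // f hf.
  apply: is_series_ext (hser f hf) => k. rewrite /laurent_term /laurent_power.
  by have -> : Z.to_nat (Z.of_nat k - Z.of_nat p + Z.of_nat p) = k by lia.
Qed.
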